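(* For every $(\Gamma,\lambda)$-commutative algebra $\mathcal{A}$ and every $\varsigma\in\mathfrak{S}(\lambda)$, with $\underline{\mathcal{A}}=I_\varsigma(\mathcal{A})$, there exists a functor $$\widehat{I}_\varsigma:\ \Gamma\text{-}\mathtt{Mod}_{\mathcal{A}}\to\Gamma\text{-}\mathtt{Mod}_{\underline{\mathcal{A}}},$$ namely the one sending $M$ to the graded vector space $M$ with $\underline{\mathcal{A}}$-module structure $a\star m=\varsigma(\tilde a,\tilde m)\,a\cdot m$ and equal to the identity on morphisms, which can be completed into a closed monoidal functor: there exist an isomorphism $u:\underline{\mathcal{A}}\to\widehat{I}_\varsigma(\mathcal{A})$ and a natural isomorphism $\tau_{M,N}:\widehat{I}_\varsigma(M)\otimes_{\underline{\mathcal{A}}}\widehat{I}_\varsigma(N)\to\widehat{I}_\varsigma(M\otimes_{\mathcal{A}}N)$ such that $(\widehat{I}_\varsigma,u,\tau)$ is a monoidal functor and such that the induced natural transformation $$\eta_{M,N}:\ \widehat{I}_\varsigma\big(\mathcal{H}om_{\mathcal{A}}(M,N)\big)\to\mathcal{H}om_{\underline{\mathcal{A}}}\big(\widehat{I}_\varsigma(M),\widehat{I}_\varsigma(N)\big)$$ is an isomorphism.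
   Context: $\mathbb{K}$ is a field of characteristic zero and $\Gamma$ is a finitely generated abelian group. $\lambda:\Gamma\times\Gamma\to\mathbb{K}^\times$ is a commutation factor: biadditive with $\lambda(x,y)\lambda(y,x)=1$. A $(\Gamma,\lambda)$-commutative algebra is an associative unital $\Gamma$-graded $\mathbb{K}$-algebra $\mathcal{A}=\bigoplus_\gamma\mathcal{A}^\gamma$ with $ab=\lambda(\tilde a,\tilde b)ba$ for homogeneous $a,b$ ($\tilde a$ is the degree). Parity $\bar x\in\mathbb{Z}_2$: $\lambda(x,x)=(-1)^{\bar x}$. $\mathfrak{S}(\lambda)$ is the set of biadditive maps $\varsigma:\Gamma\times\Gamma\to\mathbb{K}^\times$ such that $\lambda^\varsigma(x,y):=\lambda(x,y)\varsigma(x,y)\varsigma(y,x)^{-1}$ equals $(-1)^{\bar x\bar y}$. $\underline{\mathcal{A}}=I_\varsigma(\mathcal{A})$ is the graded vector space $\mathcal{A}$ with product $a\star b=\varsigma(\tilde a,\tilde b)ab$; it is a $(\Gamma,\lambda^\varsigma)$-commutative algebra. A graded $\mathcal{A}$-module is a graded vector space $M=\bigoplus_\gamma M^\gamma$ with left and right graded $\mathcal{A}$-module structures related by $ma=\lambda(\tilde m,\tilde a)am$ (for $\underline{\mathcal{A}}$, replace $\lambda$ by $\lambda^\varsigma$; this determines the right structure of $\widehat{I}_\varsigma(M)$). $\Gamma\text{-}\mathtt{Mod}_{\mathcal{A}}$ has these as objects, and as morphisms the right $\mathcal{A}$-linear maps of degree $0$. It is closed symmetric monoidal: $M\otimes_{\mathcal{A}}N$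 with grading by total degree, $a(m\otimes n)=(am)\otimes n$, $(m\otimes n)a=m\otimes(na)$, unit object $\mathcal{A}$, braiding $m\otimes n\mapsto\lambda(\tilde m,\tilde n)n\otimes m$; internal Hom $\mathcal{H}om_{\mathcal{A}}(M,N)=\bigoplus_\gamma\mathcal{H}om^\gamma_{\mathcal{A}}(M,N)$, where $\mathcal{H}om^\gamma_{\mathcal{A}}(M,N)$ is the set of right $\mathcal{A}$-linear maps $f$ with $f(M^\alpha)\subset N^{\alpha+\gamma}$ for all $\alpha$, with $(af)(m)=a f(m)$. The same applies to $\underline{\mathcal{A}}$. A monoidal functor $(F,u,\tau)$ between monoidal categories is a functor $F$ with an isomorphism $u:\mathbb{I}'\to F(\mathbb{I})$ and natural isomorphisms $\tau_{X,Y}:F(X)\otimes F(Y)\to F(X\otimes Y)$ satisfying the usual associativity and left/right unit coherence diagrams. Between closed monoidal categories it induces $\eta_{X,Y}:F(\mathcal{H}om(X,Y))\to\mathcal{H}om(F(X),F(Y))$, the morphism corresponding under the tensor–Hom adjunction to $F(\mathrm{ev})\circ\tau:F(\mathcal{H}om(X,Y))\otimes F(X)\to F(Y)$, with $\mathrm{ev}$ the evaluation; the functor is called closed if $\eta$ is an isomorphism. *)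

(* Defs.v *)
From HB Require Import structures.
From mathcomp Require Import all_boot all_order all_algebra.
From mathcomp Require Import ring_quotient generic_quotient.
From mathcomp Require Import boolp functions.
From mathcomp Require Import freeg ring.

Set Implicit Arguments.
Unset Strict Implicit.
Unset Printing Implicit Defensive.

Import GRing.Theory.
Local Open Scope ring_scope.
Local Open Scope quotient_scope.

Record category := Category {
  ob :> Type;
  chom : ob -> ob -> Type;
  idm : forall X, chom X X;
  compm : forall X Y Z, chom Y Z -> chom X Y -> chom X Z;
  comp1m : forall X Y (f : chom X Y), compm (idm Y) f = f;
  compm1 : forall X Y (f : chom X Y), compm f (idm X) = f;
  compA : forall X Y Z W (f : chom X Y) (g : chom Y Z) (h : chom Z W),
    compm h (compm g f) = compm (compm h g) f
}.

Arguments idm {c} X.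

Declare Scope cat_scope.
Delimit Scope cat_scope with cat.
Local Open Scope cat_scope.
Notation "g \oc f" := (compm g f)
  (at level 40, left associativity) : cat_scope.

Definition is_iso (C : category) (X Y : C) (f : chom X Y) : Prop :=
  exists g : chom Y X, g \oc f = idm X /\ f \oc g = idm Y.

Record monoidalCategory := MonoidalCategory {
  mc_cat :> category;
  unitob : mc_cat;
  tens : mc_cat -> mc_cat -> mc_cat;
  tensm : forall X Y X' Y' : mc_cat,
    chom X X' -> chom Y Y' -> chom (tens X Y) (tens X' Y');
  assoc : forall X Y Z : mc_cat,
    chom (tens (tens X Y) Z) (tens X (tens Y Z));
  lunit : forall X : mc_cat, chom (tens unitob X) X;
  runit : forall X : mc_cat, chom (tens X unitob) X;
  tensm_id : forall X Y : mc_cat, tensm (idm X) (idm Y) = idm (tens X Y);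
  tensm_comp : forall (X Y X' Y' X'' Y'' : mc_cat)
      (f : chom X X') (g : chom Y Y') (f' : chom X' X'') (g' : chom Y' Y''),
    tensm (f' \oc f) (g' \oc g) = tensm f' g' \oc tensm f g;
  assoc_iso : forall X Y Z : mc_cat, is_iso (assoc X Y Z);
  lunit_iso : forall X : mc_cat, is_iso (lunit X);
  runit_iso : forall X : mc_cat, is_iso (runit X);
  assoc_nat : forall (X Y Z X' Y' Z' : mc_cat)
      (f : chom X X') (g : chom Y Y') (h : chom Z Z'),
    assoc X' Y' Z' \oc tensm (tensm f g) h
    = tensm f (tensm g h) \oc assoc X Y Z;
  lunit_nat : forall (X X' : mc_cat) (f : chom X X'),
    lunit X' \oc tensm (idm unitob) f = f \oc lunit X;
  runit_nat : forall (X X' : mc_cat) (f : chom X X'),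
    runit X' \oc tensm f (idm unitob) = f \oc runit X;
  pentagon : forall X Y Z W : mc_cat,
    assoc X Y (tens Z W) \oc assoc (tens X Y) Z W
    = tensm (idm X) (assoc Y Z W) \oc assoc X (tens Y Z) W
      \oc tensm (assoc X Y Z) (idm W);
  triangle : forall X Y : mc_cat,
    tensm (idm X) (lunit Y) \oc assoc X unitob Y
    = tensm (runit X) (idm Y)
}.

Arguments unitob {m}.

Record closedMonoidalCategory := ClosedMonoidalCategory {
  cmc_mc :> monoidalCategory;
  ihom : cmc_mc -> cmc_mc -> cmc_mc;
  ev : forall X Y : cmc_mc, chom (tens (ihom X Y) X) Y;
  curry : forall X Y Z : cmc_mc, chom (tens Z X) Y -> chom Z (ihom X Y);
  curryK : forall (X Y Z : cmc_mc) (f : chom (tens Z X) Y),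
    ev X Y \oc tensm (curry f) (idm X) = f;
  evK : forall (X Y Z : cmc_mc) (g : chom Z (ihom X Y)),
    curry (ev X Y \oc tensm g (idm X)) = g
}.

Record functor_on (C D : category) (F0 : C -> D) := FunctorOn {
  fmap : forall X Y : C, chom X Y -> chom (F0 X) (F0 Y);
  fmap_id : forall X : C, fmap (idm X) = idm (F0 X);
  fmap_comp : forall (X Y Z : C) (f : chom X Y) (g : chom Y Z),
    fmap (g \oc f) = fmap g \oc fmap f
}.

Record functor (C D : category) := Functor {
  fob :> C -> D;
  fstr : functor_on fob
}.

Definition fmor (C D : category) (F : functor C D) (X Y : C) (f : chom X Y) :
  chom (F X) (F Y) := fmap (fstr F) f.

Record is_monoidal_functor (C D : monoidalCategory) (F : functor C D)
    (u : chom unitob (F unitob))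
    (tau : forall X Y : C, chom (tens (F X) (F Y)) (F (tens X Y))) : Prop :=
  IsMonoidalFunctor {
    mf_unit_iso : is_iso u;
    mf_tau_iso : forall X Y : C, is_iso (tau X Y);
    mf_tau_nat : forall (X Y X' Y' : C) (f : chom X X') (g : chom Y Y'),
      tau X' Y' \oc tensm (fmor F f) (fmor F g)
      = fmor F (tensm f g) \oc tau X Y;
    mf_assoc : forall X Y Z : C,
      fmor F (assoc X Y Z) \oc tau (tens X Y) Z
        \oc tensm (tau X Y) (idm (F Z))
      = tau X (tens Y Z) \oc tensm (idm (F X)) (tau Y Z)
        \oc assoc (F X) (F Y) (F Z);
    mf_lunit : forall X : C,
      fmor F (lunit X) \oc tau unitob X \oc tensm u (idm (F X))
      = lunit (F X);
    mf_runit : forall X : C,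
      fmor F (runit X) \oc tau X unitob \oc tensm (idm (F X)) u
      = runit (F X)
  }.

(* The canonical morphism F[X,Y] -> [FX,FY]; F is closed when it is always
   invertible. *)
Definition ihom_comparison (C D : closedMonoidalCategory) (F : functor C D)
    (tau : forall X Y : C, chom (tens (F X) (F Y)) (F (tens X Y)))
    (X Y : C) : chom (F (ihom X Y)) (ihom (F X) (F Y)) :=
  curry (fmor F (ev X Y) \oc tau (ihom X Y) X).

Definition finitely_generated (G : zmodType) : Prop :=
  exists s : seq G, forall x : G,
    exists c : 'I_(size s) -> int, x = \sum_(i < size s) s`_i *~ c i.

Definition bilin (K : fieldType) (U V W : lmodType K) (f : U -> V -> W) : Prop :=
  (forall v, linear (f^~ v)) /\ (forall u, linear (f u)).

(* [P g] is the component of degree [g]: the space is the internal direct sum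
   of the subspaces [P g]. *)
Record is_grading (K : fieldType) (G : zmodType) (V : lmodType K)
    (P : G -> V -> Prop) : Prop := IsGrading {
  homog0 : forall g, P g 0;
  homogL : forall g (c : K) v w, P g v -> P g w -> P g (c *: v + w);
  homog_span : forall v, exists (s : seq G) (f : G -> V),
    [/\ uniq s, forall g, P g (f g) & v = \sum_(g <- s) f g];
  homog_indep : forall (s : seq G) (f : G -> V), uniq s ->
    (forall g, P g (f g)) -> \sum_(g <- s) f g = 0 ->
    forall g, g \in s -> f g = 0
}.

Record gvs (K : fieldType) (G : zmodType) := Gvs {
  gcar :> lmodType K;
  homog : G -> gcar -> Prop;
  gvsP : is_grading homog
}.

Arguments homog {K G g}.

Section Bilin.
Variables (K : fieldType) (U V W : lmodType K) (f : U -> V -> W).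
Hypothesis hf : bilin f.

Lemma bilDl u u' v : f (u + u') v = f u v + f u' v.
Proof. by have := hf.1 v 1 u u'; rewrite !scale1r. Qed.
Lemma bilDr u v v' : f u (v + v') = f u v + f u v'.
Proof. by have := hf.2 u 1 v v'; rewrite !scale1r. Qed.
Lemma bil0l v : f 0 v = 0.
Proof. by apply: (addrI (f 0 v)); rewrite -bilDl !addr0. Qed.
Lemma bil0r u : f u 0 = 0.
Proof. by apply: (addrI (f u 0)); rewrite -bilDr !addr0. Qed.
Lemma bilZl c u v : f (c *: u) v = c *: f u v.
Proof. by have := hf.1 v c u 0; rewrite !addr0 bil0l addr0. Qed.
Lemma bilZr c u v : f u (c *: v) = c *: f u v.
Proof. by have := hf.2 u c v 0; rewrite !addr0 bil0r addr0. Qed.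
Lemma bilsuml I (r : seq I) F v :
  f (\sum_(i <- r) F i) v = \sum_(i <- r) f (F i) v.
Proof. by elim/big_rec2: _ => [|i y x _ <-]; rewrite ?bil0l ?bilDl. Qed.
Lemma bilsumr I (r : seq I) F u :
  f u (\sum_(i <- r) F i) = \sum_(i <- r) f u (F i).
Proof. by elim/big_rec2: _ => [|i y x _ <-]; rewrite ?bil0r ?bilDr. Qed.
End Bilin.

Section Lin.
Variables (K : fieldType) (U V : lmodType K) (f : U -> V).
Hypothesis hf : linear f.
Lemma linD u v : f (u + v) = f u + f v.
Proof. by have := hf 1 u v; rewrite !scale1r. Qed.
Lemma lin0 : f 0 = 0.
Proof. by apply: (addrI (f 0)); rewrite -linD !addr0. Qed.
Lemma linZ c u : f (c *: u) = c *: f u.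
Proof. by have := hf c u 0; rewrite !addr0 lin0 addr0. Qed.
Lemma lin_sum I (r : seq I) F :
  f (\sum_(i <- r) F i) = \sum_(i <- r) f (F i).
Proof. by elim/big_rec2: _ => [|i y x _ <-]; rewrite ?lin0 ?linD. Qed.
End Lin.

Section Components.
Variables (K : fieldType) (G : zmodType) (V : gvs K G).
Implicit Types (v w : V) (g : G).

Lemma homogD g v w : homog g v -> homog g w -> homog g (v + w).
Proof. by move=> hv hw; rewrite -[v]scale1r; apply: homogL (gvsP V) _ _ _ _ hv hw. Qed.
Lemma homogZ g c v : homog g v -> homog g (c *: v).
Proof.
by move=> hv; rewrite -[_ *: v]addr0; apply: (homogL (gvsP V)) hv (homog0 (gvsP V) g).
Qed.
Lemma homog0v g : homog g (0 : V). Proof. exact: homog0 (gvsP V) g. Qed.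
Lemma homog_sum g I (r : seq I) (F : I -> V) :
  (forall i, homog g (F i)) -> homog g (\sum_(i <- r) F i).
Proof. by move=> hF; elim/big_ind: _ => // *; [exact: homog0v | exact: homogD]. Qed.

Definition gdec v := cid (homog_span (gvsP V) v).
Definition gsupp v : seq G := sval (gdec v).
Definition gcomp g v : V :=
  if g \in gsupp v then sval (cid (svalP (gdec v))) g else 0.

Lemma gsupp_uniq v : uniq (gsupp v).
Proof. by have [? _ _] := svalP (cid (svalP (gdec v))). Qed.
Lemma gcomp_homog g v : homog g (gcomp g v).
Proof.
rewrite /gcomp; case: ifP => _; last exact: homog0v.
by have [_ h _] := svalP (cid (svalP (gdec v))).
Qed.
Lemma gcomp_out g v : g \notin gsupp v -> gcomp g v = 0.
Proof. by rewrite /gcomp => /negPf->. Qed.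
Lemma gcomp_sum v : v = \sum_(g <- gsupp v) gcomp g v.
Proof.
have [_ _ {1}->] := svalP (cid (svalP (gdec v))).
by apply: eq_big_seq => g gs; rewrite /gcomp gs.
Qed.

Lemma big_supp (W : zmodType) (s t : seq G) (F : G -> W) :
  uniq s -> uniq t -> {subset s <= t} -> (forall g, g \notin s -> F g = 0) ->
  \sum_(g <- t) F g = \sum_(g <- s) F g.
Proof.
move=> us ut st F0; rewrite (bigID (mem s)) /= [X in _ + X]big1 // addr0.
rewrite -big_filter; apply: perm_big; apply: uniq_perm; rewrite ?filter_uniq //.
by move=> g; rewrite mem_filter; apply: andb_idr => /st.
Qed.

Lemma gcomp_sumE v t : uniq t -> {subset gsupp v <= t} ->
  v = \sum_(g <- t) gcomp g v.
Proof.
move=> ut st; rewrite {1}(gcomp_sum v); apply/esym/big_supp => //.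
- exact: gsupp_uniq.
- by move=> g /gcomp_out.
Qed.

Lemma gcomp_uniq (s : seq G) (f : G -> V) : uniq s -> (forall g, homog g (f g)) ->
  (forall g, g \notin s -> f g = 0) ->
  forall g, gcomp g (\sum_(h <- s) f h) = f g.
Proof.
move=> us hf f0 g; set v := \sum_(h <- s) f h.
pose t := undup (g :: s ++ gsupp v).
have ut : uniq t by exact: undup_uniq.
have sub1 : {subset gsupp v <= t}.
  by move=> h hv; rewrite mem_undup inE mem_cat hv !orbT.
have sub2 : {subset s <= t}.
  by move=> h hs; rewrite mem_undup inE mem_cat hs orbT.
have e : \sum_(h <- t) (gcomp h v - f h) = 0.
  rewrite sumrB -(gcomp_sumE ut sub1).
  by apply/eqP; rewrite subr_eq0; apply/eqP/esym/big_supp.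
apply/eqP; rewrite -subr_eq0; apply/eqP.
apply: (homog_indep (gvsP V)) ut _ e _ _.
  by move=> h; apply: homogD; [exact: gcomp_homog | rewrite -scaleN1r; apply: homogZ].
by rewrite mem_undup inE eqxx.
Qed.

Lemma gcomp_lin g : linear (gcomp g).
Proof.
move=> c v w; pose t := undup (gsupp v ++ gsupp w).
have ut : uniq t by exact: undup_uniq.
have ev : v = \sum_(g <- t) gcomp g v.
  by apply: gcomp_sumE => // h; rewrite mem_undup mem_cat => ->.
have ew : w = \sum_(g <- t) gcomp g w.
  by apply: gcomp_sumE => // h; rewrite mem_undup mem_cat orbC => ->.
rewrite {1}ev {1}ew scaler_sumr -big_split /= gcomp_uniq //.
  by move=> h; apply: homogD (gcomp_homog _ _); apply/homogZ/gcomp_homog.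
move=> h; rewrite mem_undup mem_cat negb_or => /andP[hv hw].
by rewrite !gcomp_out // scaler0 addr0.
Qed.

Lemma gcompE g h v : homog g v -> gcomp h v = if h == g then v else 0.
Proof.
move=> hv; have := @gcomp_uniq [:: g] (fun h => if h == g then v else 0).
rewrite big_seq1 eqxx => -> //.
  by move=> k; case: eqP => [->//|_]; exact: homog0v.
by move=> k; rewrite inE => /negPf->.
Qed.

Lemma homog_ind (Q : V -> Prop) : Q 0 -> (forall v w, Q v -> Q w -> Q (v + w)) ->
  (forall g v, homog g v -> Q v) -> forall v, Q v.
Proof.
move=> Q0 QD Qh v; rewrite (gcomp_sum v); elim/big_ind: _ => // g _.
exact/Qh/gcomp_homog.
Qed.
End Components.

Lemma decomp_add (K : fieldType) (G : zmodType) (V : lmodType K)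
    (P : G -> V -> Prop) (v w : V) :
  (forall g, P g 0) -> (forall g v w, P g v -> P g w -> P g (v + w)) ->
  (exists s f, [/\ uniq s, forall g, P g (f g) & v = \sum_(g <- s) f g]) ->
  (exists s f, [/\ uniq s, forall g, P g (f g) & w = \sum_(g <- s) f g]) ->
  exists (s : seq G) (f : G -> V),
    [/\ uniq s, forall g, P g (f g) & v + w = \sum_(g <- s) f g].
Proof.
move=> P0 PD [s [f [us hf ->]]] [s' [f' [us' hf' ->]]].
pose c (r : seq G) h : G -> V := fun g => if g \in r then h g else 0.
exists (undup (s ++ s')), (fun g => c s f g + c s' f' g).
split; first exact: undup_uniq.
  by move=> g; apply: PD; rewrite /c; case: ifP.
have e t (h : G -> V) : uniq t -> {subset t <= s ++ s'} ->
    \sum_(g <- t) h g = \sum_(g <- undup (s ++ s')) c t h g.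
  move=> ut st; rewrite (@big_supp _ _ t _ (c t h)) ?undup_uniq //.
  - by apply: eq_big_seq => g gt; rewrite /c gt.
  - by move=> g gt; rewrite mem_undup; apply: st.
  - by move=> g; rewrite /c => /negPf->.
rewrite big_split -!e //; first by move=> g; rewrite mem_cat orbC => ->.
by move=> g; rewrite mem_cat => ->.
Qed.

(* The bilinear map which is [c g h *: b v w] on homogeneous elements
   [v], [w] of respective degrees [g], [h]. *)
Definition weighted (K : fieldType) (G : zmodType) (U V : gvs K G)
    (W : lmodType K) (c : G -> G -> K) (b : U -> V -> W) (v : U) (w : V) : W :=
  \sum_(g <- gsupp v) \sum_(h <- gsupp w) c g h *: b (gcomp g v) (gcomp h w).

Section Weighted.
Variables (K : fieldType) (G : zmodType) (U V : gvs K G) (W : lmodType K).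
Variables (c : G -> G -> K) (b : U -> V -> W).
Hypothesis hb : bilin b.

Lemma weighted_supp s t v w : uniq s -> uniq t ->
  {subset gsupp v <= s} -> {subset gsupp w <= t} ->
  weighted c b v w = \sum_(g <- s) \sum_(h <- t) c g h *: b (gcomp g v) (gcomp h w).
Proof.
move=> us ut vs wt; symmetry; rewrite (@big_supp _ _ (gsupp v)) ?gsupp_uniq //.
  apply: eq_bigr => g _; rewrite (@big_supp _ _ (gsupp w)) ?gsupp_uniq //.
  by move=> h /gcomp_out->; rewrite (bil0r hb) scaler0.
by move=> g /gcomp_out->; rewrite big1 // => h _; rewrite (bil0l hb) scaler0.
Qed.

Lemma weighted_bilin : bilin (weighted c b).
Proof.
split=> [w|v] a x y.
- pose s := undup (gsupp (a *: x + y) ++ gsupp x ++ gsupp y).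
  have us : uniq s by exact: undup_uniq.
  rewrite !(@weighted_supp s (gsupp w)) ?gsupp_uniq //;
    try by move=> h; rewrite mem_undup !mem_cat => ->; rewrite ?orbT.
  rewrite scaler_sumr -big_split /=; apply: eq_bigr => g _.
  rewrite scaler_sumr -big_split /=; apply: eq_bigr => h _.
  by rewrite gcomp_lin (bilDl hb) (bilZl hb) scalerDr !scalerA mulrC.
- pose s := undup (gsupp (a *: x + y) ++ gsupp x ++ gsupp y).
  have us : uniq s by exact: undup_uniq.
  rewrite !(@weighted_supp (gsupp v) s) ?gsupp_uniq //;
    try by move=> h; rewrite mem_undup !mem_cat => ->; rewrite ?orbT.
  rewrite scaler_sumr -big_split /=; apply: eq_bigr => g _.
  rewrite scaler_sumr -big_split /=; apply: eq_bigr => h _.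
  by rewrite gcomp_lin (bilDr hb) (bilZr hb) scalerDr !scalerA mulrC.
Qed.

Lemma weightedE g h v w : homog g v -> homog h w ->
  weighted c b v w = c g h *: b v w.
Proof.
move=> hv hw; pose s := undup (g :: gsupp v); pose t := undup (h :: gsupp w).
have us : uniq s by exact: undup_uniq.
have ut : uniq t by exact: undup_uniq.
rewrite (@weighted_supp s t) //;
  try by move=> k; rewrite mem_undup inE orbC => ->.
rewrite (@big_supp _ _ [:: g]) //; first last.
- by move=> k; rewrite inE => kg; rewrite (gcompE _ hv) (negPf kg)
    big1 // => l _; rewrite (bil0l hb) scaler0.
- by move=> k; rewrite inE => /eqP->; rewrite mem_undup inE eqxx.
rewrite big_seq1 (@big_supp _ _ [:: h]) //; first last.
- by move=> k; rewrite inE => kg; rewrite (gcompE _ hw) (negPf kg)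
    (bil0r hb) scaler0.
- by move=> k; rewrite inE => /eqP->; rewrite mem_undup inE eqxx.
by rewrite big_seq1 (gcompE _ hv) (gcompE _ hw) !eqxx.
Qed.
End Weighted.

(* The values are invertible by [cfV]. *)
Record commFactor (K : fieldType) (G : zmodType) := CommFactor {
  cf :> G -> G -> K;
  cfDl : forall x y z, cf (x + y) z = cf x z * cf y z;
  cfDr : forall x y z, cf x (y + z) = cf x y * cf x z;
  cfV : forall x y, cf x y * cf y x = 1
}.

(* [true] stands for the odd parity; see [parityP]. *)
Definition parity (K : fieldType) (G : zmodType) (lam : commFactor K G) (x : G) :
  bool := lam x x == -1.

(* The elements of the set 𝔖(λ). *)
Record multiplier (K : fieldType) (G : zmodType) (lam : commFactor K G) :=
  Multiplier {
    mult :> G -> G -> K;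
    mult_neq0 : forall x y, mult x y != 0;
    multDl : forall x y z, mult (x + y) z = mult x z * mult y z;
    multDr : forall x y z, mult x (y + z) = mult x y * mult x z;
    mult_super : forall x y,
      lam x y * mult x y * (mult y x)^-1 = (-1) ^+ (parity lam x && parity lam y)
  }.

(* Not built on [algType], which excludes the zero algebra.  The field
   [aone_homog] follows from the other ones, but is part of the usual notion. *)
Record gradedAlgebra (K : fieldType) (G : zmodType) := GradedAlgebra {
  ga_gvs :> gvs K G;
  amul : ga_gvs -> ga_gvs -> ga_gvs;
  aone : ga_gvs;
  amul_bilin : bilin amul;
  amulA : associative amul;
  amul1l : left_id aone amul;
  amul1r : right_id aone amul;
  aone_homog : homog 0 aone;
  amul_homog : forall g h a b,
    homog g a -> homog h b -> homog (g + h) (amul a b)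
}.

Arguments aone {K G _}.

Record gcAlgebra (K : fieldType) (G : zmodType) (lam : commFactor K G) :=
  GcAlgebra {
    gca_ga :> gradedAlgebra K G;
    amulC : forall g h (a b : gca_ga), homog g a -> homog h b ->
      amul a b = lam g h *: amul b a
  }.

Lemma cf_neq0 (K : fieldType) (G : zmodType) (lam : commFactor K G) x y :
  lam x y != 0.
Proof.
apply/eqP => h; have := cfV lam x y; rewrite h mul0r => /esym/eqP.
by rewrite oner_eq0.
Qed.

Lemma parityP (K : fieldType) (G : zmodType) (lam : commFactor K G) x :
  lam x x = (-1) ^+ parity lam x.
Proof.
rewrite /parity; case: eqP => [->|ne]; first by rewrite expr1.
rewrite expr0; apply/eqP; have /eqP := cfV lam x x.
by rewrite -expr2 sqrf_eq1 => /orP[//|/eqP/ne].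
Qed.

Section Twist.
Variables (K : fieldType) (G : zmodType) (lam : commFactor K G).
Variable (sig : multiplier lam).

Definition twist_cf_fun (x y : G) : K := lam x y * sig x y * (sig y x)^-1.

Fact twist_cfDl x y z :
  twist_cf_fun (x + y) z = twist_cf_fun x z * twist_cf_fun y z.
Proof.
by rewrite /twist_cf_fun cfDl multDl multDr; field; rewrite !mult_neq0.
Qed.

Fact twist_cfDr x y z :
  twist_cf_fun x (y + z) = twist_cf_fun x y * twist_cf_fun x z.
Proof.
by rewrite /twist_cf_fun cfDr multDl multDr; field; rewrite !mult_neq0.
Qed.

Fact twist_cfV x y : twist_cf_fun x y * twist_cf_fun y x = 1.
Proof.
rewrite -(cfV lam x y) /twist_cf_fun; field; by rewrite !mult_neq0.
Qed.

Definition twist_cf : commFactor K G :=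
  CommFactor twist_cfDl twist_cfDr twist_cfV.

Variable (A : gcAlgebra lam).

Definition twist_mul : A -> A -> A := weighted sig (@amul K G A).

Fact twist_mul_bilin : bilin twist_mul.
Proof. exact/weighted_bilin/amul_bilin. Qed.

Lemma twist_mulE g h (a b : A) : homog g a -> homog h b ->
  twist_mul a b = sig g h *: amul a b.
Proof. exact/weightedE/amul_bilin. Qed.

Lemma mult0l x : sig 0 x = 1.
Proof.
apply: (mulfI (mult_neq0 sig 0 x)).
by rewrite -multDl addr0 mulr1.
Qed.

Lemma mult0r x : sig x 0 = 1.
Proof.
apply: (mulfI (mult_neq0 sig x 0)).
by rewrite -multDr addr0 mulr1.
Qed.

Fact twist_mul_homog g h a b :
  homog g a -> homog h b -> homog (g + h) (twist_mul a b).
Proof.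
by move=> ha hb; rewrite (twist_mulE ha hb); apply/homogZ/amul_homog.
Qed.

Fact twist_mulA : associative twist_mul.
Proof.
have tb := twist_mul_bilin.
elim/homog_ind => [b c|a a' IH IH' b c|g a ha]; rewrite ?(bil0l tb) //.
  by rewrite !(bilDl tb) IH IH'.
elim/homog_ind => [c|b b' IH IH' c|h b hb].
- by rewrite (bil0l tb) !(bil0r tb) (bil0l tb).
- by rewrite !(bilDl tb) !(bilDr tb) IH IH' (bilDl tb).
elim/homog_ind => [|c c' IH IH'|k c hc]; rewrite ?(bil0r tb) //.
  by rewrite !(bilDr tb) IH IH'.
rewrite (twist_mulE ha (twist_mul_homog hb hc)) (twist_mulE hb hc).
rewrite (twist_mulE (twist_mul_homog ha hb) hc) (twist_mulE ha hb).
rewrite (bilZr (amul_bilin A)) (bilZl (amul_bilin A)) !scalerA amulA.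
by congr (_ *: _); rewrite multDl multDr; ring.
Qed.

Fact twist_mul1l : left_id aone twist_mul.
Proof.
elim/homog_ind => [|c c' IH IH'|k c hc].
- exact: (bil0r twist_mul_bilin).
- by rewrite (bilDr twist_mul_bilin) IH IH'.
by rewrite (twist_mulE (aone_homog A) hc) mult0l scale1r amul1l.
Qed.

Fact twist_mul1r : right_id aone twist_mul.
Proof.
elim/homog_ind => [|c c' IH IH'|k c hc].
- exact: (bil0l twist_mul_bilin).
- by rewrite (bilDl twist_mul_bilin) IH IH'.
by rewrite (twist_mulE hc (aone_homog A)) mult0r scale1r amul1r.
Qed.

Definition twist_ga : gradedAlgebra K G :=
  GradedAlgebra twist_mul_bilin twist_mulA twist_mul1l twist_mul1r
    (aone_homog A) twist_mul_homog.

Fact twist_mulC g h (a b : twist_ga) : homog g a -> homog h b ->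
  amul a b = twist_cf g h *: amul b a.
Proof.
move=> ha hb; rewrite /= (twist_mulE ha hb) (twist_mulE hb ha).
rewrite (amulC ha hb) !scalerA; congr (_ *: _).
by rewrite /twist_cf_fun mulfVK ?mult_neq0 // mulrC.
Qed.

(* The algebra I_ς(A). *)
Definition twist : gcAlgebra twist_cf := GcAlgebra twist_mulC.
End Twist.

Record gmodStr (K : fieldType) (G : zmodType) (lam : commFactor K G)
    (A : gcAlgebra lam) (V : gvs K G) := GmodStr {
  lact : A -> V -> V;
  ract : V -> A -> V;
  lact_bilin : bilin lact;
  ract_bilin : bilin ract;
  lactA : forall a b m, lact a (lact b m) = lact (amul a b) m;
  lact1 : forall m, lact aone m = m;
  ractA : forall m a b, ract (ract m a) b = ract m (amul a b);
  ract1 : forall m, ract m aone = m;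
  lact_homog : forall g h a m, homog g a -> homog h m -> homog (g + h) (lact a m);
  ract_homog : forall g h m a, homog g m -> homog h a -> homog (g + h) (ract m a);
  ractE : forall g h m a, homog g m -> homog h a ->
    ract m a = lam g h *: lact a m
}.

Record gmod (K : fieldType) (G : zmodType) (lam : commFactor K G)
    (A : gcAlgebra lam) := Gmod {
  gm_gvs :> gvs K G;
  gm_str : gmodStr A gm_gvs
}.

Definition lmul (K : fieldType) (G : zmodType) (lam : commFactor K G)
  (A : gcAlgebra lam) (M : gmod A) (a : A) (m : M) : M := lact (gm_str M) a m.
Definition rmul (K : fieldType) (G : zmodType) (lam : commFactor K G)
  (A : gcAlgebra lam) (M : gmod A) (m : M) (a : A) : M := ract (gm_str M) m a.

Record gmodHom (K : fieldType) (G : zmodType) (lam : commFactor K G)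
    (A : gcAlgebra lam) (M N : gmod A) := GmodHom {
  hfun :> M -> N;
  hlin : linear hfun;
  hrmul : forall m a, hfun (rmul m a) = rmul (hfun m) a;
  hhomog : forall g m, homog g m -> homog g (hfun m)
}.

Section Modules.
Variables (K : fieldType) (G : zmodType) (lam : commFactor K G).
Variable (A : gcAlgebra lam).
Implicit Types M N P Q : gmod A.

Lemma lmul_bilin M : bilin (@lmul _ _ _ A M). Proof. exact: lact_bilin. Qed.
Lemma rmul_bilin M : bilin (@rmul _ _ _ A M). Proof. exact: ract_bilin. Qed.
Lemma lmulA M a b (m : M) : lmul a (lmul b m) = lmul (amul a b) m.
Proof. exact: lactA. Qed.
Lemma rmulA M a b (m : M) : rmul (rmul m a) b = rmul m (amul a b).
Proof. exact: ractA. Qed.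
Lemma lmul1 M (m : M) : lmul aone m = m. Proof. exact: lact1. Qed.
Lemma rmul1 M (m : M) : rmul m aone = m. Proof. exact: ract1. Qed.
Lemma lmul_homog M g h a (m : M) :
  homog g a -> homog h m -> homog (g + h) (lmul a m).
Proof. exact: lact_homog. Qed.
Lemma rmul_homog M g h a (m : M) :
  homog g m -> homog h a -> homog (g + h) (rmul m a).
Proof. exact: ract_homog. Qed.
Lemma rmulE M g h a (m : M) : homog g m -> homog h a ->
  rmul m a = lam g h *: lmul a m.
Proof. exact: ractE. Qed.
Lemma lmulE M g h a (m : M) : homog g m -> homog h a ->
  lmul a m = lam h g *: rmul m a.
Proof.
by move=> hm ha; rewrite (rmulE hm ha) scalerA cfV scale1r.
Qed.

Lemma lrmul M a b (m : M) : rmul (lmul a m) b = lmul a (rmul m b).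
Proof.
have lb := lmul_bilin M; have rb := rmul_bilin M.
elim/homog_ind: a => [|a a' IH IH'|g a ha].
- by rewrite !(bil0l lb) (bil0l rb).
- by rewrite !(bilDl lb) (bilDl rb) IH IH'.
elim/homog_ind: m => [|m m' IH IH'|h m hm].
- by rewrite (bil0r lb) (bil0l rb) (bil0r lb).
- by rewrite (bilDr lb) !(bilDl rb) (bilDr lb) IH IH'.
elim/homog_ind: b => [|b b' IH IH'|k b hb].
- by rewrite !(bil0r rb) (bil0r lb).
- by rewrite !(bilDr rb) (bilDr lb) IH IH'.
rewrite (rmulE (lmul_homog ha hm) hb) (rmulE hm hb) (bilZr lb) !lmulA.
by rewrite (amulC ha hb) (bilZl lb) scalerA cfDl mulrC.
Qed.

Lemma hlmul M N (f : gmodHom M N) a m : f (lmul a m) = lmul a (f m).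
Proof.
have lM := lmul_bilin M; have lN := lmul_bilin N; have fl := hlin f.
elim/homog_ind: a => [|a a' IH IH'|g a ha].
- by rewrite !(bil0l lM) (lin0 fl) (bil0l lN).
- by rewrite !(bilDl lM) (linD fl) (bilDl lN) IH IH'.
elim/homog_ind: m => [|m m' IH IH'|h m hm].
- by rewrite (bil0r lM) (lin0 fl) (bil0r lN).
- by rewrite (bilDr lM) !(linD fl) (bilDr lN) IH IH'.
by rewrite (lmulE hm ha) (lmulE (hhomog f hm) ha) (linZ fl) hrmul.
Qed.

Lemma gmodHom_eq M N (f g : gmodHom M N) : (forall m, f m = g m) -> f = g.
Proof.
case: f g => [f f1 f2 f3] [g g1 g2 g3] /= /funext e; subst g.
by congr GmodHom; exact: Prop_irrelevance.
Qed.

Definition gidm M : gmodHom M M :=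
  @GmodHom _ _ _ _ M M id (fun c u v => erefl) (fun m a => erefl)
    (fun g m h => h).

Definition gcompm M N P (f : gmodHom N P) (g : gmodHom M N) : gmodHom M P.
Proof.
exists (fun m => f (g m)).
- by move=> c u v; rewrite (hlin g) (hlin f).
- by move=> m a; rewrite !hrmul.
- by move=> h m hm; apply/hhomog/hhomog.
Defined.

Definition gmod_cat : category.
Proof.
by exists (gmod A) (@gmodHom _ _ _ A) gidm gcompm => *; apply: gmodHom_eq.
Defined.

Lemma gmcompE M N P (g : gmodHom N P) (f : gmodHom M N) m :
  hfun (@compm gmod_cat M N P g f) m = g (f m).
Proof. by []. Qed.

Lemma gidE M m : hfun (@idm gmod_cat M) m = m. Proof. by []. Qed.

Definition unit_str : gmodStr A A :=
  @GmodStr _ _ _ A A (@amul _ _ A) (@amul _ _ A) (amul_bilin A) (amul_bilin A)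
    (fun a b m => amulA a b m) (@amul1l _ _ A)
    (fun m a b => esym (amulA m a b)) (@amul1r _ _ A)
    (@amul_homog _ _ A) (@amul_homog _ _ A) (@amulC _ _ _ A).

Definition gunit : gmod A := Gmod unit_str.
End Modules.

Section TensorCarrier.
Variables (K : fieldType) (G : zmodType) (lam : commFactor K G).
Variables (A : gcAlgebra lam) (M N : gmod A).

Local Notation F := {freeg (M * N)%type / K}.

Definition tgen (m : M) (n : N) : F := << (m, n) >>.

(* The subspace of relations defining [M ⊗_A N] as a quotient of the free
   vector space on [M * N]. *)
Inductive tens_rel : F -> Prop :=
| TrelZero : tens_rel 0
| TrelLin c x y : tens_rel x -> tens_rel y -> tens_rel (c *: x + y)
| TrelLeft c m m' n :
    tens_rel (tgen (c *: m + m') n - (c *: tgen m n + tgen m' n))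
| TrelRight c m n n' :
    tens_rel (tgen m (c *: n + n') - (c *: tgen m n + tgen m n'))
| TrelBal m a n : tens_rel (tgen (rmul m a) n - tgen m (lmul a n)).

Definition tens_rel_pred : {pred F} := fun x => `[< tens_rel x >].

Fact tens_rel_zmod : zmod_closed tens_rel_pred.
Proof.
split; first exact/asboolP/TrelZero.
move=> x y /asboolP hx /asboolP hy; apply/asboolP.
by rewrite addrC -scaleN1r; apply: TrelLin.
Qed.

HB.instance Definition _ := GRing.isZmodClosed.Build F tens_rel_pred tens_rel_zmod.

Definition tensor : Type := Quotient.quot tens_rel_pred.
HB.instance Definition _ := GRing.Zmodule.on tensor.

Definition tpi : F -> tensor := \pi_(Quotient.quot tens_rel_pred).

Lemma tpiD x y : tpi (x + y) = tpi x + tpi y.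
Proof. exact: raddfD. Qed.

Lemma tpi_eq x y : tpi x = tpi y <-> tens_rel (x - y).
Proof.
split=> [/eqP|h]; first by rewrite /tpi -Quotient.idealrBE => /asboolP.
by apply/eqP; rewrite /tpi -Quotient.idealrBE; apply/asboolP.
Qed.

Lemma tpi_surj (t : tensor) : tpi (repr t) = t.
Proof. exact: reprK. Qed.

Definition tscale (c : K) (t : tensor) : tensor := tpi (c *: repr t).

Lemma tpiZ c x : tscale c (tpi x) = tpi (c *: x).
Proof.
apply/tpi_eq; rewrite -scalerBr -[_ *: _]addr0; apply: TrelLin TrelZero.
by apply/tpi_eq; rewrite tpi_surj.
Qed.

Fact tscaleA a b t : tscale a (tscale b t) = tscale (a * b) t.
Proof. by rewrite -(tpi_surj t) !tpiZ scalerA. Qed.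
Fact tscale1 : left_id 1 tscale.
Proof. by move=> t; rewrite -(tpi_surj t) tpiZ scale1r. Qed.
Fact tscaleDr : right_distributive tscale +%R.
Proof.
move=> c t u; rewrite -(tpi_surj t) -(tpi_surj u) -tpiD !tpiZ.
by rewrite scalerDr tpiD.
Qed.
Fact tscaleDl t : {morph tscale^~ t : a b / a + b}.
Proof. by move=> a b; rewrite -(tpi_surj t) !tpiZ scalerDl tpiD. Qed.

HB.instance Definition _ := GRing.Zmodule_isLmodule.Build K tensor
  tscaleA tscale1 tscaleDr tscaleDl.

Definition tpure (m : M) (n : N) : tensor := tpi (tgen m n).

Lemma tpi_lin : linear tpi.
Proof. by move=> c x y; rewrite tpiD -tpiZ. Qed.

Lemma tpure_bilin : bilin tpure.
Proof.
split=> [n|m] c x y; rewrite /tpure -tpi_lin; apply/tpi_eq.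
  exact: TrelLeft.
exact: TrelRight.
Qed.

Lemma tpure_bal m a n : tpure (rmul m a) n = tpure m (lmul a n).
Proof. by apply/tpi_eq; apply: TrelBal. Qed.

Lemma tensor_ind (Q : tensor -> Prop) : (forall t u, Q t -> Q u -> Q (t + u)) ->
  (forall m n, Q (tpure m n)) -> forall t, Q t.
Proof.
move=> QD Qp t; rewrite -(tpi_surj t) -[repr t]freeg_sumE (lin_sum tpi_lin).
elim/big_ind: _ => //.
  by have := Qp 0 0; rewrite (bil0l tpure_bilin).
move=> [m n] _; set k := coeff _ _.
have -> : << k *g (m, n) >> = k *: tgen m n.
  apply/eqP/freeg_eqP => z; rewrite coeffZ !coeffU mul1r //.
by rewrite (linZ tpi_lin) -/(tpure m n) -(bilZl tpure_bilin).
Qed.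

Section Lift.
Variables (W : lmodType K) (f : M -> N -> W).

Definition balanced := bilin f /\ (forall m a n, f (rmul m a) n = f m (lmul a n)).

Definition tlift (t : tensor) : W := fglift (fun p => f p.1 p.2) (repr t).

Hypothesis fbal : balanced.

Lemma fglift_lin (T : choiceType) (f' : T -> W) :
  linear (fglift f' : {freeg T / K} -> W).
Proof.
have addf : additive (fglift f') by exact: lift_is_additive.
pose g := HB.pack_for {additive {freeg T / K} -> W} (fglift f')
  (GRing.isAdditive.Build _ _ _ addf).
move=> c x y; rewrite -[fglift f']/(g : _ -> _) raddfD; congr (_ + _).
rewrite -[in RHS](freeg_sumE x) -[c *: x]/(fgscale c x) /fgscale !raddf_sum.
apply: eq_bigr => z _; rewrite /g /=.
by rewrite !liftU scalerA.
Qed.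

Lemma tlift_pi x : tlift (tpi x) = fglift (fun p => f p.1 p.2) x.
Proof.
have fl := fglift_lin (fun p => f p.1 p.2).
apply/eqP; rewrite -subr_eq0 -[_ - _]addrC -scaleN1r -fl addrC.
have : tens_rel (-1 *: x + repr (tpi x)).
  by rewrite scaleN1r addrC; apply/tpi_eq; rewrite tpi_surj.
have fgen m n : fglift (fun p => f p.1 p.2) (tgen m n) = f m n.
  by rewrite liftU scale1r.
rewrite addrC; elim=> [|c u v _ /eqP hu _ /eqP hv|c m m' n|c m n n'|m a n];
  rewrite ?[_ - _]addrC -?scaleN1r ?fl ?(lin0 fl) ?(linZ fl) ?fl ?fgen ?scaleN1r //.
- by rewrite hu hv scaler0 addr0.
- by rewrite fbal.1.1 addNr.
- by rewrite fbal.1.2 addNr.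
- by rewrite fbal.2 addNr.
Qed.

Lemma tlift_lin : linear tlift.
Proof.
move=> c t u; rewrite -(tpi_surj t) -(tpi_surj u) -tpi_lin !tlift_pi.
exact: fglift_lin.
Qed.

Lemma tliftE m n : tlift (tpure m n) = f m n.
Proof. by rewrite tlift_pi liftU scale1r. Qed.
End Lift.

Lemma tensor_hind (Q : tensor -> Prop) : (forall t u, Q t -> Q u -> Q (t + u)) ->
  (forall g h m n, homog g m -> homog h n -> Q (tpure m n)) -> forall t, Q t.
Proof.
move=> QD Qp; apply: tensor_ind => //.
have Q0 : Q 0.
  have := Qp 0 0 0 0 (homog0v M 0) (homog0v N 0).
  by rewrite (bil0l tpure_bilin).
elim/homog_ind => [n|m m' IH IH' n|g m hm].
- by rewrite (bil0l tpure_bilin).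
- by rewrite (bilDl tpure_bilin); apply: QD.
elim/homog_ind => [|n n' IH IH'|h n hn].
- by rewrite (bil0r tpure_bilin).
- by rewrite (bilDr tpure_bilin); apply: QD.
exact: Qp hm hn.
Qed.

Lemma lin_tensor_ext (W : lmodType K) (f f' : tensor -> W) :
  linear f -> linear f' -> (forall m n, f (tpure m n) = f' (tpure m n)) ->
  forall t, f t = f' t.
Proof.
move=> fl fl' e; apply: tensor_ind => // t u et eu.
by rewrite (linD fl) (linD fl') et eu.
Qed.

Inductive tens_homog (g : G) : tensor -> Prop :=
| TensHomogZero : tens_homog g 0
| TensHomogD t u : tens_homog g t -> tens_homog g u -> tens_homog g (t + u)
| TensHomogPure h k m n : homog h m -> homog k n -> h + k = g ->
    tens_homog g (tpure m n).

Lemma tens_homogZ g c t : tens_homog g t -> tens_homog g (c *: t).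
Proof.
elim=> [|u v _ hu _ hv|h k m n hm hn e]; rewrite ?scaler0 ?scalerDr.
- exact: TensHomogZero.
- exact: TensHomogD.
rewrite -(bilZl tpure_bilin); apply: TensHomogPure hn e; exact: homogZ.
Qed.

Definition tens_comp (g : G) : tensor -> tensor :=
  tlift (weighted (fun h k => (h + k == g)%:R) tpure).

Lemma weighted_bal (W : lmodType K) (c : G -> G -> K) (f : M -> N -> W) :
  balanced f -> (forall g h k, c (g + h) k = c g (h + k)) ->
  balanced (weighted c f).
Proof.
move=> [fb fbal] cc; have wb := weighted_bilin c fb; split=> // m a n.
have lb := lmul_bilin N; have rb := rmul_bilin M.
elim/homog_ind: m => [|m m' IH IH'|g m hm].
- by rewrite (bil0l rb) !(bil0l wb).
- by rewrite (bilDl rb) !(bilDl wb) IH IH'.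
elim/homog_ind: a => [|a a' IH IH'|h a ha].
- by rewrite (bil0l lb) (bil0r rb) (bil0l wb) (bil0r wb).
- by rewrite (bilDl lb) (bilDr rb) (bilDl wb) (bilDr wb) IH IH'.
elim/homog_ind: n => [|n n' IH IH'|k n hn].
- by rewrite (bil0r lb) !(bil0r wb).
- by rewrite (bilDr lb) !(bilDr wb) IH IH'.
rewrite (weightedE c fb (rmul_homog hm ha) hn).
by rewrite (weightedE c fb hm (lmul_homog ha hn)) fbal cc.
Qed.

Lemma tpure_balanced : balanced tpure.
Proof. by split; [exact: tpure_bilin | exact: tpure_bal]. Qed.

Lemma tens_comp_bal g :
  balanced (weighted (fun h k => (h + k == g)%:R) tpure).
Proof.
by apply: weighted_bal; [exact: tpure_balanced | move=> *; rewrite addrA].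
Qed.

Lemma tens_compE g h t : tens_homog h t ->
  tens_comp g t = if h == g then t else 0.
Proof.
have tl := tlift_lin (tens_comp_bal g).
elim=> [|u v _ hu _ hv|k l m n hm hn e].
- by rewrite /tens_comp (lin0 tl) if_same.
- by rewrite /tens_comp (linD tl) [X in X + _]hu [X in _ + X]hv; case: ifP;
    rewrite ?addr0.
rewrite /tens_comp (tliftE (tens_comp_bal g)) (weightedE _ tpure_bilin hm hn) e.
by case: eqP; rewrite ?scale1r ?scale0r.
Qed.

Fact tens_grading : is_grading tens_homog.
Proof.
split.
- exact: TensHomogZero.
- by move=> g c v w hv hw; apply: TensHomogD => //; apply: tens_homogZ.
- apply: tensor_hind => [t u ht hu|g h m n hm hn].
    by apply: decomp_add ht hu; [exact: TensHomogZero | exact: TensHomogD].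
  exists [:: g + h], (fun k => if k == g + h then tpure m n else 0).
  split=> //; last by rewrite big_seq1 eqxx.
  move=> k; case: eqP => [->|_]; last exact: TensHomogZero.
  exact: TensHomogPure hm hn erefl.
- move=> s f us hf e g gs.
  have tl := tlift_lin (tens_comp_bal g).
  have := congr1 (tens_comp g) e; rewrite {2}/tens_comp (lin0 tl).
  rewrite /tens_comp (lin_sum tl) (bigD1_seq g) //= big1 => [|h hg].
    by rewrite addr0 -/(tens_comp g _) (tens_compE _ (hf g)) eqxx.
  by rewrite -/(tens_comp g _) (tens_compE _ (hf h)) (negPf hg).
Qed.

Definition tens_gvs : gvs K G := Gvs tens_grading.

Definition tens_lact (a : A) : tensor -> tensor :=
  tlift (fun m n => tpure (lmul a m) n).
Definition tens_ract (t : tensor) (a : A) : tensor :=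
  tlift (fun m n => tpure m (rmul n a)) t.

Lemma tens_lact_bal a : balanced (fun m n => tpure (lmul a m) n).
Proof.
have tb := tpure_bilin; have lb := lmul_bilin M.
split; first split=> [n|m] c x y.
- by rewrite (bilDr lb) (bilZr lb) (bilDl tb) (bilZl tb).
- by rewrite (bilDr tb) (bilZr tb).
- by move=> m b n; rewrite -lrmul tpure_bal.
Qed.

Lemma tens_ract_bal a : balanced (fun m n => tpure m (rmul n a)).
Proof.
have tb := tpure_bilin; have rb := rmul_bilin N.
split; first split=> [n|m] c x y.
- by rewrite (bilDl tb) (bilZl tb).
- by rewrite (bilDl rb) (bilZl rb) (bilDr tb) (bilZr tb).
- by move=> m b n; rewrite tpure_bal lrmul.
Qed.

Lemma tens_lactE a m n : tens_lact a (tpure m n) = tpure (lmul a m) n.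
Proof. exact: tliftE (tens_lact_bal a) m n. Qed.
Lemma tens_ractE a m n : tens_ract (tpure m n) a = tpure m (rmul n a).
Proof. exact: tliftE (tens_ract_bal a) m n. Qed.

Fact tens_lact_bilin : bilin tens_lact.
Proof.
have tb := tpure_bilin; have lb := lmul_bilin M.
have tl a : linear (tens_lact a) := tlift_lin (tens_lact_bal a).
split=> // t c a b; elim/tensor_ind: t => [t u IH IH'|m n].
  rewrite !(linD (tl _)) IH IH' scalerDr.
  by rewrite -!addrA; congr (_ + _); rewrite addrCA.
by rewrite !tens_lactE (bilDl lb) (bilZl lb) (bilDl tb) (bilZl tb).
Qed.

Fact tens_ract_bilin : bilin tens_ract.
Proof.
have tb := tpure_bilin; have rb := rmul_bilin N.
have tl a : linear (tens_ract^~ a) := tlift_lin (tens_ract_bal a).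
split=> // t c a b; elim/tensor_ind: t => [t u IH IH'|m n].
  rewrite !(linD (tl _)) IH IH' scalerDr.
  by rewrite -!addrA; congr (_ + _); rewrite addrCA.
by rewrite !tens_ractE (bilDr rb) (bilZr rb) (bilDr tb) (bilZr tb).
Qed.

Fact tens_lactA a b t : tens_lact a (tens_lact b t) = tens_lact (amul a b) t.
Proof.
elim/tensor_ind: t => [t u IH IH'|m n]; last by rewrite !tens_lactE lmulA.
by rewrite !(bilDr tens_lact_bilin) IH IH'.
Qed.

Fact tens_lact1 t : tens_lact aone t = t.
Proof.
elim/tensor_ind: t => [t u IH IH'|m n]; last by rewrite !tens_lactE lmul1.
by rewrite (bilDr tens_lact_bilin) IH IH'.
Qed.

Fact tens_ractA t a b : tens_ract (tens_ract t a) b = tens_ract t (amul a b).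
Proof.
elim/tensor_ind: t => [t u IH IH'|m n]; last by rewrite !tens_ractE rmulA.
by rewrite !(bilDl tens_ract_bilin) IH IH'.
Qed.

Fact tens_ract1 t : tens_ract t aone = t.
Proof.
elim/tensor_ind: t => [t u IH IH'|m n]; last by rewrite !tens_ractE rmul1.
by rewrite (bilDl tens_ract_bilin) IH IH'.
Qed.

Fact tens_lact_homog g h a t :
  homog g a -> tens_homog h t -> tens_homog (g + h) (tens_lact a t).
Proof.
have lb := tens_lact_bilin; move=> ha.
elim=> [|u v _ hu _ hv|k l m n hm hn <-].
- by rewrite (bil0r lb); apply: TensHomogZero.
- by rewrite (bilDr lb); apply: TensHomogD.
- rewrite tens_lactE addrA; apply: TensHomogPure hn erefl.
  exact: lmul_homog.
Qed.

Fact tens_ract_homog g h t a :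
  tens_homog g t -> homog h a -> tens_homog (g + h) (tens_ract t a).
Proof.
have rb := tens_ract_bilin; move=> + ha.
elim=> [|u v _ hu _ hv|k l m n hm hn <-].
- by rewrite (bil0l rb); apply: TensHomogZero.
- by rewrite (bilDl rb); apply: TensHomogD.
- rewrite tens_ractE -addrA; apply: TensHomogPure hm _ erefl.
  exact: rmul_homog.
Qed.

Fact tens_ract_lact g h t a : tens_homog g t -> homog h a ->
  tens_ract t a = lam g h *: tens_lact a t.
Proof.
have lb := tens_lact_bilin; have rb := tens_ract_bilin; move=> + ha.
elim=> [|u v _ hu _ hv|k l m n hm hn <-].
- by rewrite (bil0l rb) (bil0r lb) scaler0.
- by rewrite (bilDl rb) (bilDr lb) hu hv scalerDr.
rewrite tens_ractE tens_lactE (rmulE hn ha) (bilZr tpure_bilin).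
rewrite -tpure_bal (rmulE hm ha) (bilZl tpure_bilin) scalerA.
by rewrite cfDl mulrC.
Qed.

Definition tens_str : gmodStr A tens_gvs :=
  @GmodStr _ _ _ A tens_gvs tens_lact tens_ract tens_lact_bilin tens_ract_bilin
    tens_lactA tens_lact1 tens_ractA tens_ract1 tens_lact_homog tens_ract_homog
    tens_ract_lact.

Definition gtens : gmod A := Gmod tens_str.

Lemma lmul_tpure a m n :
  lmul a (tpure m n : gtens) = (tpure (lmul a m) n : gtens).
Proof. exact: tens_lactE. Qed.
Lemma rmul_tpure m n a :
  rmul (tpure m n : gtens) a = (tpure m (rmul n a) : gtens).
Proof. exact: tens_ractE. Qed.
End TensorCarrier.

Arguments tpure {K G lam A M N} m n.

Section Monoidal.
Variables (K : fieldType) (G : zmodType) (lam : commFactor K G).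
Variable (A : gcAlgebra lam).
Implicit Types M N P Q : gmod A.

Section GtensHom.
Variables (M N P : gmod A) (f : M -> N -> P).
Hypothesis fbal : balanced f.
Hypothesis fr : forall m n a, f m (rmul n a) = rmul (f m n) a.
Hypothesis fh : forall g h m n,
  homog g m -> homog h n -> homog (g + h) (f m n).

Fact gtens_hom_rmul (t : gtens M N) a : tlift f (rmul t a) = rmul (tlift f t) a.
Proof.
have tl := tlift_lin fbal; have rb := rmul_bilin P.
elim/tensor_ind: t => [t u IH IH'|m n].
  by rewrite (bilDl (rmul_bilin (gtens M N))) !(linD tl) (bilDl rb) IH IH'.
by rewrite rmul_tpure !(tliftE fbal).
Qed.

Fact gtens_hom_homog g (t : gtens M N) : homog g t -> homog g (tlift f t).
Proof.
have tl := tlift_lin fbal; elim=> [|u v _ hu _ hv|h k m n hm hn <-].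
- by rewrite (lin0 tl); apply: homog0v.
- by rewrite (linD tl); apply: homogD.
- by rewrite (tliftE fbal); apply: fh.
Qed.

Definition gtens_hom : gmodHom (gtens M N) P :=
  @GmodHom _ _ _ _ (gtens M N) P (tlift f) (tlift_lin fbal) gtens_hom_rmul
    gtens_hom_homog.
End GtensHom.

Lemma gtens_homE M N P f fbal fr fh m n :
  @gtens_hom M N P f fbal fr fh (tpure m n) = f m n.
Proof. exact: tliftE. Qed.

Lemma gtens_ext M N P (f f' : gmodHom (gtens M N) P) :
  (forall m n, f (tpure m n) = f' (tpure m n)) -> f = f'.
Proof.
by move=> e; apply: gmodHom_eq; apply: (lin_tensor_ext (hlin f) (hlin f') e).
Qed.

Lemma gtens_ext3 M N P Q (f f' : gmodHom (gtens (gtens M N) P) Q) :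
  (forall m n p, f (tpure (tpure m n : gtens M N) p)
               = f' (tpure (tpure m n : gtens M N) p)) -> f = f'.
Proof.
move=> e; apply: gtens_ext => t p; have tb := @tpure_bilin _ _ _ _ (gtens M N) P.
elim/tensor_ind: t => [t u IH IH'|m n]; last exact: e.
by rewrite (bilDl tb) (linD (hlin f)) (linD (hlin f')) IH IH'.
Qed.

Lemma gtens_ext4 M N P Q R
    (f f' : gmodHom (gtens (gtens (gtens M N) P) Q) R) :
  (forall m n p q,
     f (tpure (tpure (tpure m n : gtens M N) p : gtens (gtens M N) P) q)
   = f' (tpure (tpure (tpure m n : gtens M N) p : gtens (gtens M N) P) q)) ->
  f = f'.
Proof.
move=> e; apply: gtens_ext3 => t p q.
have tb := @tpure_bilin _ _ _ _ (gtens M N) P.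
have tb' := @tpure_bilin _ _ _ _ (gtens (gtens M N) P) Q.
elim/tensor_ind: t => [t u IH IH'|m n]; last exact: e.
by rewrite (bilDl tb) (bilDl tb') (linD (hlin f)) (linD (hlin f')) IH IH'.
Qed.

Section TensHom.
Variables (M N M' N' : gmod A) (f : gmodHom M M') (g : gmodHom N N').

Fact gtensm_bal : balanced (fun m n => tpure (f m) (g n)).
Proof.
have tb := @tpure_bilin _ _ _ _ M' N'; have fl := hlin f; have gl := hlin g.
split; first split=> [n|m] c x y.
- by rewrite fl (bilDl tb) (bilZl tb).
- by rewrite gl (bilDr tb) (bilZr tb).
- by move=> m a n; rewrite hrmul hlmul tpure_bal.
Qed.

Fact gtensm_rmul (m : M) (n : N) a :
  (tpure (f m) (g (rmul n a)) : gtens M' N')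
  = rmul (tpure (f m) (g n) : gtens M' N') a.
Proof. by rewrite hrmul rmul_tpure. Qed.

Fact gtensm_homog k h (m : M) (n : N) : homog k m -> homog h n ->
  homog (k + h) (tpure (f m) (g n) : gtens M' N').
Proof.
by move=> hm hn; apply: TensHomogPure (hhomog f hm) (hhomog g hn) erefl.
Qed.

Definition gtensm : gmodHom (gtens M N) (gtens M' N') :=
  gtens_hom (P := gtens M' N') gtensm_bal gtensm_rmul gtensm_homog.

Lemma gtensmE m n : gtensm (tpure m n) = tpure (f m) (g n).
Proof. exact: gtens_homE. Qed.
End TensHom.

Section Assoc.
Variables M N P : gmod A.

Definition gassoc_fun (p : P) (t : gtens M N) : gtens M (gtens N P) :=
  tlift (fun m n => tpure m (tpure n p : gtens N P)) t.

Lemma gassoc_fun_bal p :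
  balanced (fun m n => tpure m (tpure n p : gtens N P) : gtens M (gtens N P)).
Proof.
have tb := @tpure_bilin _ _ _ _ M (gtens N P).
have tb' := @tpure_bilin _ _ _ _ N P.
split; first split=> [n|m] c x y.
- by rewrite (bilDl tb) (bilZl tb).
- by rewrite (bilDl tb') (bilZl tb') (bilDr tb) (bilZr tb).
- by move=> m a n; rewrite tpure_bal lmul_tpure.
Qed.

Lemma gassoc_funE p m n : gassoc_fun p (tpure m n) = tpure m (tpure n p : gtens N P).
Proof. exact: tliftE (gassoc_fun_bal p) m n. Qed.

Fact gassoc_bal : balanced (fun (t : gtens M N) (p : P) => gassoc_fun p t).
Proof.
have tb := @tpure_bilin _ _ _ _ M (gtens N P).
have tb' := @tpure_bilin _ _ _ _ N P.
have tl p : linear (gassoc_fun p) := tlift_lin (gassoc_fun_bal p).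
split; first split=> [p|t] c x y.
- exact: tl.
- elim/tensor_ind: t => [t u IH IH'|m n].
    rewrite !(linD (tl _)) IH IH' scalerDr.
    by rewrite -!addrA; congr (_ + _); rewrite addrCA.
  by rewrite !gassoc_funE (bilDr tb') (bilZr tb') (bilDr tb) (bilZr tb).
- move=> t a p; elim/tensor_ind: t => [t u IH IH'|m n].
    by rewrite (bilDl (rmul_bilin (gtens M N))) !(linD (tl _)) IH IH'.
  by rewrite rmul_tpure !gassoc_funE tpure_bal.
Qed.

Fact gassoc_rmul (t : gtens M N) (p : P) a :
  gassoc_fun (rmul p a) t = rmul (gassoc_fun p t) a.
Proof.
have tl q : linear (gassoc_fun q) := tlift_lin (gassoc_fun_bal q).
elim/tensor_ind: t => [t u IH IH'|m n].
  by rewrite !(linD (tl _)) (bilDl (rmul_bilin _)) IH IH'.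
by rewrite !gassoc_funE !rmul_tpure.
Qed.

Fact gassoc_homog g h (t : gtens M N) (p : P) :
  homog g t -> homog h p -> homog (g + h) (gassoc_fun p t).
Proof.
have tl q : linear (gassoc_fun q) := tlift_lin (gassoc_fun_bal q).
move=> + hp; elim=> [|u v _ hu _ hv|k l m n hm hn <-].
- by rewrite (lin0 (tl _)); apply: homog0v.
- by rewrite (linD (tl _)); apply: homogD.
- rewrite gassoc_funE -addrA; apply: TensHomogPure hm _ erefl.
  exact: TensHomogPure hn hp erefl.
Qed.

Definition gassoc : gmodHom (gtens (gtens M N) P) (gtens M (gtens N P)) :=
  gtens_hom gassoc_bal gassoc_rmul gassoc_homog.

Lemma gassocE m n p :
  gassoc (tpure (tpure m n : gtens M N) p) = tpure m (tpure n p : gtens N P).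
Proof. by rewrite gtens_homE gassoc_funE. Qed.

Definition gcossa_fun (m : M) (t : gtens N P) : gtens (gtens M N) P :=
  tlift (fun n p => tpure (tpure m n : gtens M N) p) t.

Lemma gcossa_fun_bal m :
  balanced (fun n p => tpure (tpure m n : gtens M N) p : gtens (gtens M N) P).
Proof.
have tb := @tpure_bilin _ _ _ _ (gtens M N) P.
have tb' := @tpure_bilin _ _ _ _ M N.
split; first split=> [n|p] c x y.
- by rewrite (bilDr tb') (bilZr tb') (bilDl tb) (bilZl tb).
- by rewrite (bilDr tb) (bilZr tb).
- by move=> n a p; rewrite -tpure_bal rmul_tpure.
Qed.

Lemma gcossa_funE m n p : gcossa_fun m (tpure n p) = tpure (tpure m n : gtens M N) p.
Proof. exact: tliftE (gcossa_fun_bal m) n p. Qed.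

Fact gcossa_bal : balanced gcossa_fun.
Proof.
have tb := @tpure_bilin _ _ _ _ (gtens M N) P.
have tb' := @tpure_bilin _ _ _ _ M N.
have tl m : linear (gcossa_fun m) := tlift_lin (gcossa_fun_bal m).
split; first split=> [t|m] c x y.
- elim/tensor_ind: t => [t u IH IH'|n p].
    rewrite !(linD (tl _)) IH IH' scalerDr.
    by rewrite -!addrA; congr (_ + _); rewrite addrCA.
  by rewrite !gcossa_funE (bilDl tb') (bilZl tb') (bilDl tb) (bilZl tb).
- exact: tl.
- move=> m a t; elim/tensor_ind: t => [t u IH IH'|n p].
    by rewrite (bilDr (lmul_bilin (gtens N P))) !(linD (tl _)) IH IH'.
  by rewrite lmul_tpure !gcossa_funE tpure_bal.
Qed.

Fact gcossa_rmul (m : M) (t : gtens N P) a :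
  gcossa_fun m (rmul t a) = rmul (gcossa_fun m t) a.
Proof.
have tl x : linear (gcossa_fun x) := tlift_lin (gcossa_fun_bal x).
elim/tensor_ind: t => [t u IH IH'|n p].
  rewrite (bilDl (rmul_bilin (gtens N P))) !(linD (tl _)) IH IH'.
  by rewrite (bilDl (rmul_bilin _)).
by rewrite rmul_tpure !gcossa_funE rmul_tpure.
Qed.

Fact gcossa_homog g h (m : M) (t : gtens N P) :
  homog g m -> homog h t -> homog (g + h) (gcossa_fun m t).
Proof.
have tl x : linear (gcossa_fun x) := tlift_lin (gcossa_fun_bal x).
move=> hm; elim=> [|u v _ hu _ hv|k l n p hn hp <-].
- by rewrite (lin0 (tl _)); apply: homog0v.
- by rewrite (linD (tl _)); apply: homogD.
- rewrite gcossa_funE addrA; apply: TensHomogPure _ hp erefl.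
  exact: TensHomogPure hm hn erefl.
Qed.

Definition gcossa : gmodHom (gtens M (gtens N P)) (gtens (gtens M N) P) :=
  gtens_hom gcossa_bal gcossa_rmul gcossa_homog.

Lemma gcossaE m n p :
  gcossa (tpure m (tpure n p : gtens N P)) = tpure (tpure m n : gtens M N) p.
Proof. by rewrite gtens_homE gcossa_funE. Qed.

Fact gassoc_iso : @is_iso (gmod_cat A) _ _ gassoc.
Proof.
exists gcossa; split.
  by apply: gtens_ext3 => m n p; rewrite gmcompE gassocE gcossaE.
apply: gtens_ext => m t; have tb := @tpure_bilin _ _ _ _ M (gtens N P).
elim/tensor_ind: t => [t u IH IH'|n p]; last by rewrite gmcompE gcossaE gassocE.
by rewrite (bilDr tb) !(linD (hlin _)) IH IH'.
Qed.
End Assoc.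

Section Units.
Variable M : gmod A.

Fact glunit_bal : balanced (fun (a : gunit A) (m : M) => lmul (a : A) m).
Proof. by split; [exact: lmul_bilin | move=> a b m; rewrite lmulA]. Qed.

Definition glunit : gmodHom (gtens (gunit A) M) M :=
  gtens_hom glunit_bal (fun a m b => esym (lrmul a b m))
    (fun g h a m => @lmul_homog _ _ _ A M g h a m).

Lemma glunitE (a : A) m : glunit (tpure (a : gunit A) m) = lmul a m.
Proof. exact: gtens_homE. Qed.

Fact grunit_bal : balanced (fun (m : M) (a : gunit A) => rmul m (a : A)).
Proof. by split; [exact: rmul_bilin | move=> a b m; rewrite rmulA]. Qed.

Definition grunit : gmodHom (gtens M (gunit A)) M :=
  gtens_hom grunit_bal (fun m a b => esym (rmulA a b m))
    (fun g h m a => @rmul_homog _ _ _ A M g h a m).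

Lemma grunitE (a : A) m : grunit (tpure m (a : gunit A)) = rmul m a.
Proof. exact: gtens_homE. Qed.

Fact glunit_iso : @is_iso (gmod_cat A) _ _ glunit.
Proof.
have tb := @tpure_bilin _ _ _ _ (gunit A) M.
unshelve eexists.
  exists (fun m => tpure (aone : gunit A) m : gtens (gunit A) M).
  - exact: tb.2.
  - by move=> m a; rewrite rmul_tpure.
  - move=> g m hm.
    exact: TensHomogPure (aone_homog A : homog 0 (aone : gunit A)) hm (add0r g).
split; last by apply: gmodHom_eq => m; rewrite gmcompE glunitE lmul1.
apply: gtens_ext => a m; rewrite gmcompE gidE glunitE /= -tpure_bal.
by congr (tpure _ m); rewrite /rmul /= amul1l.
Qed.

Fact grunit_iso : @is_iso (gmod_cat A) _ _ grunit.
Proof.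
have tb := @tpure_bilin _ _ _ _ M (gunit A).
unshelve eexists.
  exists (fun m => tpure m (aone : gunit A) : gtens M (gunit A)).
  - exact: tb.1.
  - move=> m a; rewrite tpure_bal rmul_tpure; congr tpure.
    by rewrite /lmul /rmul /= amul1l amul1r.
  - move=> g m hm.
    exact: TensHomogPure hm (aone_homog A : homog 0 (aone : gunit A)) (addr0 g).
split; last by apply: gmodHom_eq => m; rewrite gmcompE grunitE rmul1.
apply: gtens_ext => m a; rewrite gmcompE gidE grunitE /= tpure_bal.
by congr (tpure m _); rewrite /lmul /= amul1r.
Qed.
End Units.

Definition gmod_mc : monoidalCategory.
Proof.
exists (gmod_cat A) (gunit A) (@gtens _ _ _ A) gtensm gassoc glunit grunit.
- by move=> X Y; apply: gtens_ext => x y; rewrite gtensmE.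
- move=> X Y X' Y' X'' Y'' f g f' g'.
  by apply: gtens_ext => x y; rewrite !(gmcompE, gtensmE).
- exact: gassoc_iso.
- exact: glunit_iso.
- exact: grunit_iso.
- move=> X Y Z X' Y' Z' f g h; apply: gtens_ext3 => x y z.
  by rewrite !(gmcompE, gidE, gtensmE, gassocE).
- move=> X X' f; apply: gtens_ext => a x.
  by rewrite !(gmcompE, gidE, gtensmE, glunitE) hlmul.
- move=> X X' f; apply: gtens_ext => x a.
  by rewrite !(gmcompE, gidE, gtensmE, grunitE) hrmul.
- move=> X Y Z W; apply: gtens_ext4 => x y z w.
  by rewrite !(gmcompE, gidE, gtensmE, gassocE).
- move=> X Y; apply: gtens_ext3 => x a y.
  by rewrite !(gmcompE, gidE, gtensmE, gassocE, glunitE, grunitE) tpure_bal.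
Defined.
End Monoidal.

Section InternalHom.
Variables (K : fieldType) (G : zmodType) (lam : commFactor K G).
Variables (A : gcAlgebra lam) (M N : gmod A).

Definition rlinear_deg (g : G) (f : M -> N) : Prop :=
  [/\ linear f, forall m a, f (rmul m a) = rmul (f m) a
    & forall h m, homog h m -> homog (h + g) (f m)].

(* The sum, inside all maps [M -> N], of the spaces of right [A]-linear maps
   of fixed degree. *)
Definition ihom_pred : {pred M -> N} := fun f =>
  `[< exists (s : seq G) (F : G -> M -> N),
        [/\ uniq s, forall g, rlinear_deg g (F g) & f = \sum_(g <- s) F g] >].

Lemma rlinear_deg0 g : rlinear_deg g 0.
Proof.
split=> [c u v|m a|h m _]; rewrite /= ?scaler0 ?addr0 //; last exact: homog0v.
by rewrite (bil0l (rmul_bilin N)).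
Qed.

Lemma rlinear_degL g c f f' : rlinear_deg g f -> rlinear_deg g f' ->
  rlinear_deg g (c *: f + f').
Proof.
have rb := rmul_bilin N; move=> [fl fr fh] [fl' fr' fh'].
have e m : (c *: f + f') m = c *: f m + f' m by [].
split=> [k u v|m a|h m hm]; rewrite !e.
- rewrite fl fl' !scalerDr !scalerA [k * c]mulrC -!addrA; congr (_ + _).
  by rewrite addrCA.
- by rewrite (bilDl rb) (bilZl rb) -fr -fr'.
- by apply: homogD; [apply/homogZ/fh | apply/fh'].
Qed.

Lemma rlinear_degD g f f' : rlinear_deg g f -> rlinear_deg g f' ->
  rlinear_deg g (f + f').
Proof. by move=> hf hf'; rewrite -[f]scale1r; apply: rlinear_degL. Qed.

Lemma ihom_deg g f : rlinear_deg g f -> f \in ihom_pred.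
Proof.
move=> hf; apply/asboolP; exists [:: g], (fun h => if h == g then f else 0).
split=> //; last by rewrite big_seq1 eqxx.
by move=> h; case: eqP => [->//|_]; apply: rlinear_deg0.
Qed.

Fact ihom_submod : submod_closed ihom_pred.
Proof.
split; first exact/(@ihom_deg 0)/rlinear_deg0.
move=> c f f' /asboolP[s [F [us hF ->]]] /asboolP hf'; apply/asboolP.
apply: decomp_add => //; [exact: rlinear_deg0 | exact: rlinear_degD |].
exists s, (fun g => c *: F g); split=> //; last by rewrite scaler_sumr.
by move=> g; rewrite -[_ *: _]addr0; apply: rlinear_degL (rlinear_deg0 g).
Qed.

HB.instance Definition _ :=
  GRing.isSubmodClosed.Build K (M -> N) ihom_pred ihom_submod.

Record ihomType := IhomType { ihom_fun :> M -> N; ihomP : ihom_fun \in ihom_pred }.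
HB.instance Definition _ := [isSub for ihom_fun].
HB.instance Definition _ := [Choice of ihomType by <:].
HB.instance Definition _ := [SubChoice_isSubLmodule of ihomType by <:].

Lemma ihom_eq (f f' : ihomType) : (forall m, f m = f' m) -> f = f'.
Proof. by move=> e; apply/val_inj/funext. Qed.

Lemma ihom_lin (f : ihomType) : linear f.
Proof.
have /asboolP[s [F [_ hF e]]] := ihomP f; rewrite e => c u v.
rewrite !fct_sumE scaler_sumr -big_split; apply: eq_bigr => g _.
by have [-> _ _] := hF g.
Qed.

Lemma ihom_rmul (f : ihomType) m a : f (rmul m a) = rmul (f m) a.
Proof.
have /asboolP[s [F [_ hF e]]] := ihomP f; rewrite e !fct_sumE.
rewrite (bilsuml (rmul_bilin N)); apply: eq_bigr => g _.
by have [_ -> _] := hF g.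
Qed.

Definition ihom_homog (g : G) (f : ihomType) : Prop :=
  forall h m, homog h m -> homog (h + g) (f m).

Lemma ihomDE (f f' : ihomType) m : (f + f') m = f m + f' m. Proof. by []. Qed.
Lemma ihomZE c (f : ihomType) m : (c *: f) m = c *: f m. Proof. by []. Qed.
Lemma ihom0E m : (0 : ihomType) m = 0. Proof. by []. Qed.
Lemma ihom_sumE I (r : seq I) (F : I -> ihomType) m :
  (\sum_(i <- r) F i) m = \sum_(i <- r) F i m.
Proof. by elim/big_rec2: _ => // i y x _ <-. Qed.

Fact ihom_grading : is_grading ihom_homog.
Proof.
split.
- by move=> g h m _; apply: homog0v.
- move=> g c f f' hf hf' h m hm.
  by rewrite ihomDE ihomZE; apply: homogD; [apply/homogZ/hf | apply: hf'].
- move=> f; have /asboolP[s [F [us hF e]]] := ihomP f.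
  exists s, (fun g => IhomType (ihom_deg (hF g))); split=> //.
    by move=> g h m hm /=; have [_ _] := hF g; apply.
  by apply: ihom_eq => m; rewrite ihom_sumE e fct_sumE.
- move=> s F us hF e g gs; apply: ihom_eq.
  have fl := ihom_lin (F g).
  elim/homog_ind => [|m m' IH IH'|h m hm]; first by rewrite (lin0 fl).
    by rewrite (linD fl) IH IH' !ihom0E addr0.
  have e' : \sum_(k <- [seq h + k | k <- s]) F (k - h) m = 0.
    rewrite big_map -[RHS](ihom0E m) -e ihom_sumE.
    by apply: eq_bigr => k _; rewrite [h + k]addrC addrK.
  have := homog_indep (gvsP N) (f := fun k => F (k - h) m) _ _ e' (g := h + g).
  rewrite [h + g]addrC addrK ihom0E; apply.
  + by rewrite map_inj_uniq //; apply: addrI.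
  + by move=> k; have := hF (k - h) h m hm; rewrite addrC subrK.
  + by apply/mapP; exists g; rewrite // addrC.
Qed.

Definition ihom_gvs : gvs K G := Gvs ihom_grading.

Lemma ihom_lact_in a (f : ihomType) : (fun m => lmul a (f m)) \in ihom_pred.
Proof.
have lb := lmul_bilin N; have /asboolP[s [F [us hF e]]] := ihomP f.
have -> : (fun m => lmul a (f m)) = \sum_(g <- s) (fun m => lmul a (F g m)).
  by apply/funext => m; rewrite e !fct_sumE (bilsumr lb).
apply: rpred_sum => h _; have [fl fr fh] := hF h.
elim/homog_ind: a => [|a a' IH IH'|g a ha].
- have -> : (fun m => lmul 0 (F h m)) = 0; last exact: rpred0.
  by apply/funext => m; rewrite (bil0l lb).
- have -> : (fun m => lmul (a + a') (F h m))
      = (fun m => lmul a (F h m)) + (fun m => lmul a' (F h m)); last exact: rpredD.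
  by apply/funext => m; rewrite (bilDl lb).
apply: (@ihom_deg (g + h)); split=> [c u v|m b|k m hm].
- by rewrite fl (bilDr lb) (bilZr lb).
- by rewrite fr lrmul.
- by rewrite addrCA; apply: lmul_homog ha _; apply: fh.
Qed.

Lemma ihom_ract_in a (f : ihomType) : (fun m => f (lmul a m)) \in ihom_pred.
Proof.
have lb := lmul_bilin M.
have /asboolP[s [F [us hF e]]] := ihomP f.
have -> : (fun m => f (lmul a m)) = \sum_(g <- s) (fun m => F g (lmul a m)).
  by apply/funext => m; rewrite e !fct_sumE.
apply: rpred_sum => h _; have [fl fr fh] := hF h.
elim/homog_ind: a => [|a a' IH IH'|g a ha].
- have -> : (fun m => F h (lmul 0 m)) = 0; last exact: rpred0.
  by apply/funext => m; rewrite (bil0l lb) (lin0 fl).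
- have -> : (fun m => F h (lmul (a + a') m))
      = (fun m => F h (lmul a m)) + (fun m => F h (lmul a' m)); last exact: rpredD.
  by apply/funext => m; rewrite (bilDl lb) (linD fl).
apply: (@ihom_deg (g + h)); split=> [c u v|m b|k m hm].
- by rewrite (bilDr lb) (bilZr lb) fl.
- by rewrite -lrmul fr.
- by rewrite addrA [k + g]addrC; apply/fh/lmul_homog.
Qed.

Definition ihom_lact (a : A) (f : ihomType) : ihomType :=
  IhomType (ihom_lact_in a f).
(* The right action determined by the left one. *)
Definition ihom_ract (f : ihomType) (a : A) : ihomType :=
  IhomType (ihom_ract_in a f).

Fact ihom_lact_bilin : bilin ihom_lact.
Proof.
have lN := lmul_bilin N.
split=> [f|a] c x y; apply: ihom_eq => m; rewrite ihomDE ihomZE /=.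
  by rewrite (bilDl lN) (bilZl lN).
by rewrite (bilDr lN) (bilZr lN).
Qed.

Fact ihom_ract_bilin : bilin ihom_ract.
Proof.
have lM := lmul_bilin M.
split=> f c x y; apply: ihom_eq => m; rewrite ihomDE ihomZE //=.
by rewrite (bilDl lM) (bilZl lM) (ihom_lin f).
Qed.

Fact ihom_lactA a b f : ihom_lact a (ihom_lact b f) = ihom_lact (amul a b) f.
Proof. by apply: ihom_eq => m /=; rewrite lmulA. Qed.

Fact ihom_lact1 f : ihom_lact aone f = f.
Proof. by apply: ihom_eq => m /=; rewrite lmul1. Qed.

Fact ihom_ractA f a b : ihom_ract (ihom_ract f a) b = ihom_ract f (amul a b).
Proof. by apply: ihom_eq => m /=; rewrite lmulA. Qed.

Fact ihom_ract1 f : ihom_ract f aone = f.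
Proof. by apply: ihom_eq => m /=; rewrite lmul1. Qed.

Fact ihom_lact_homog g h a f :
  homog g a -> ihom_homog h f -> ihom_homog (g + h) (ihom_lact a f).
Proof.
by move=> ha hf k m hm /=; rewrite addrCA; apply: lmul_homog ha (hf _ _ hm).
Qed.

Fact ihom_ract_homog g h f a :
  ihom_homog g f -> homog h a -> ihom_homog (g + h) (ihom_ract f a).
Proof.
move=> hf ha k m hm /=; rewrite [g + h]addrC addrA [k + h]addrC.
exact/hf/lmul_homog.
Qed.

Fact ihom_ract_lact g h f a : ihom_homog g f -> homog h a ->
  ihom_ract f a = lam g h *: ihom_lact a f.
Proof.
have lM := lmul_bilin M; move=> hf ha; apply: ihom_eq.
elim/homog_ind => [|m m' IH IH'|k m hm].
- by rewrite !(lin0 (ihom_lin _)).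
- by rewrite !(linD (ihom_lin _)) IH IH'.
rewrite ihomZE /= (lmulE hm ha) (linZ (ihom_lin f)) ihom_rmul.
rewrite (rmulE (hf _ _ hm) ha) scalerA; congr (_ *: _).
by rewrite cfDl mulrA cfV mul1r.
Qed.

Definition ihom_str : gmodStr A ihom_gvs :=
  @GmodStr _ _ _ A ihom_gvs ihom_lact ihom_ract ihom_lact_bilin ihom_ract_bilin
    ihom_lactA ihom_lact1 ihom_ractA ihom_ract1 ihom_lact_homog ihom_ract_homog
    ihom_ract_lact.

Definition gihom : gmod A := Gmod ihom_str.

Fact gev_bal : balanced (fun (f : gihom) (m : M) => f m).
Proof.
split; first split=> [m|f] c x y //; first exact: ihom_lin.
by [].
Qed.

Fact gev_rmul (f : gihom) m a : f (rmul m a) = rmul (f m) a.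
Proof. exact: ihom_rmul. Qed.

Fact gev_homog g h (f : gihom) m :
  homog g f -> homog h m -> homog (g + h) (f m).
Proof. by move=> hf hm; rewrite addrC; apply: hf. Qed.

Definition gev : gmodHom (gtens gihom M) N :=
  gtens_hom gev_bal gev_rmul gev_homog.

Lemma gevE (f : gihom) m : gev (tpure f m) = f m.
Proof. exact: gtens_homE. Qed.
End InternalHom.

Section Curry.
Variables (K : fieldType) (G : zmodType) (lam : commFactor K G).
Variables (A : gcAlgebra lam) (M N P : gmod A).
Variable f : gmodHom (gtens P M) N.

Lemma gcurry_deg g p : homog g p ->
  rlinear_deg g (fun m => f (tpure p m)).
Proof.
have tb := @tpure_bilin _ _ _ _ P M => hp; split.
- by move=> c u v; rewrite (bilDr tb) (bilZr tb) (hlin f).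
- by move=> m a; rewrite -hrmul rmul_tpure.
- move=> h m hm; apply: hhomog; exact: TensHomogPure hp hm (addrC _ _).
Qed.

Lemma gcurry_in p : (fun m => f (tpure p m)) \in @ihom_pred _ _ _ A M N.
Proof.
have tb := @tpure_bilin _ _ _ _ P M; have fl := hlin f.
elim/homog_ind: p => [|p p' IH IH'|g p hp].
- have -> : (fun m => f (tpure 0 m)) = 0; last exact: rpred0.
  by apply/funext => m; rewrite (bil0l tb) (lin0 fl).
- have -> : (fun m => f (tpure (p + p') m))
      = (fun m => f (tpure p m)) + (fun m => f (tpure p' m)); last exact: rpredD.
  by apply/funext => m; rewrite (bilDl tb) (linD fl).
exact/ihom_deg/(gcurry_deg hp).
Qed.

Definition gcurry_fun (p : P) : gihom M N := IhomType (gcurry_in p).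

Fact gcurry_lin : linear gcurry_fun.
Proof.
have tb := @tpure_bilin _ _ _ _ P M => c p p'; apply: ihom_eq => m /=.
by rewrite (bilDl tb) (bilZl tb) (hlin f).
Qed.

Fact gcurry_rmul p a : gcurry_fun (rmul p a) = rmul (gcurry_fun p) a.
Proof. by apply: ihom_eq => m /=; rewrite tpure_bal. Qed.

Fact gcurry_homog g p : homog g p -> homog g (gcurry_fun p).
Proof. by move=> hp h m hm; have [_ _] := gcurry_deg hp; apply. Qed.

Definition gcurry : gmodHom P (gihom M N) :=
  GmodHom gcurry_lin gcurry_rmul gcurry_homog.

Lemma gcurryE p m : gcurry p m = f (tpure p m). Proof. by []. Qed.
End Curry.

Definition gmod_cmc (K : fieldType) (G : zmodType) (lam : commFactor K G)
  (A : gcAlgebra lam) : closedMonoidalCategory.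
Proof.
exists (gmod_mc A) (@gihom _ _ _ A) (@gev _ _ _ A) (@gcurry _ _ _ A).
- by move=> X Y Z f; apply: gtens_ext => z x; rewrite gmcompE gtensmE gevE.
- move=> X Y Z g; apply: gmodHom_eq => z; apply: ihom_eq => x.
  by rewrite gcurryE gmcompE gtensmE gevE.
Defined.

(* Main.v *)
Require Import Defs.
From HB Require Import structures.
From mathcomp Require Import all_boot all_order all_algebra.
From mathcomp Require Import ring.

Set Implicit Arguments.
Unset Strict Implicit.
Unset Printing Implicit Defensive.

Import GRing.Theory.
Local Open Scope ring_scope.

(** The structure maps of the twisted category are those of the original one,
    each bilinear operation being reweighted by ς on homogeneous components:
    τ(m ⊗ n) = ς(m,n) m ⊗ n, and then η(f)(m) = ς(f,m) f(m).  Since ς is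
    biadditive, it satisfies ς(g,h) ς(g+h,k) = ς(h,k) ς(g,h+k), so every
    associativity-like identity between bilinear operations survives the
    reweighting; since ς takes invertible values, τ and η are bijective. *)

(** * Bilinear operations reweighted by a biadditive factor *)

Section WeightedOperations.
Variables (K : fieldType) (G : zmodType).

Lemma bilin_hext (U V : gvs K G) (W : lmodType K) (f f' : U -> V -> W) :
  bilin f -> bilin f' ->
  (forall g h u v, homog g u -> homog h v -> f u v = f' u v) ->
  forall u v, f u v = f' u v.
Proof.
move=> fb fb' e; elim/homog_ind => [v|u u' IH IH' v|g u hu].
- by rewrite (bil0l fb) (bil0l fb').
- by rewrite (bilDl fb) (bilDl fb') IH IH'.
elim/homog_ind => [|v v' IH IH'|h v hv]; last exact: e hu hv.
- by rewrite (bil0r fb) (bil0r fb').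
- by rewrite (bilDr fb) (bilDr fb') IH IH'.
Qed.

Lemma weighted_homog (U V W : gvs K G) (c : G -> G -> K) (b : U -> V -> W) :
  bilin b ->
  (forall g h u v, homog g u -> homog h v -> homog (g + h) (b u v)) ->
  forall g h u v, homog g u -> homog h v -> homog (g + h) (weighted c b u v).
Proof.
by move=> bb bh g h u v hu hv; rewrite (weightedE c bb hu hv); apply/homogZ/bh.
Qed.

(** On homogeneous elements of degrees g, h, k both sides acquire the factor c(g,h) c(g,k) c(h,k).
    The four operations are kept independent so that one statement yields associativity of both
    twisted actions, and balancedness and right linearity of τ. *)
Lemma weighted_assoc (U V W UV VW : gvs K G) (X : lmodType K) (c : G -> G -> K)
    (b1 : UV -> W -> X) (b2 : U -> V -> UV)
    (b3 : U -> VW -> X) (b4 : V -> W -> VW) :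
  (forall x y z, c (x + y) z = c x z * c y z) ->
  (forall x y z, c x (y + z) = c x y * c x z) ->
  bilin b1 -> bilin b2 -> bilin b3 -> bilin b4 ->
  (forall g h u v, homog g u -> homog h v -> homog (g + h) (b2 u v)) ->
  (forall g h v w, homog g v -> homog h w -> homog (g + h) (b4 v w)) ->
  (forall u v w, b1 (b2 u v) w = b3 u (b4 v w)) ->
  forall u v w, weighted c b1 (weighted c b2 u v) w
              = weighted c b3 u (weighted c b4 v w).
Proof.
move=> cDl cDr h1 h2 h3 h4 h2h h4h e.
have w1 := weighted_bilin c h1; have w2 := weighted_bilin c h2.
have w3 := weighted_bilin c h3; have w4 := weighted_bilin c h4.
elim/homog_ind => [v w|u u' IH IH' v w|g u hu].
- by rewrite (bil0l w2) (bil0l w1) (bil0l w3).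
- by rewrite (bilDl w2) (bilDl w1) (bilDl w3) IH IH'.
elim/homog_ind => [w|v v' IH IH' w|h v hv].
- by rewrite (bil0r w2) (bil0l w1) (bil0l w4) (bil0r w3).
- by rewrite (bilDr w2) (bilDl w1) (bilDl w4) (bilDr w3) IH IH'.
elim/homog_ind => [|w w' IH IH'|k w hw].
- by rewrite (bil0r w1) (bil0r w4) (bil0r w3).
- by rewrite (bilDr w1) (bilDr w4) (bilDr w3) IH IH'.
rewrite (weightedE c h1 (weighted_homog c h2 h2h hu hv) hw).
rewrite (weightedE c h3 hu (weighted_homog c h4 h4h hv hw)).
rewrite (weightedE c h2 hu hv) (weightedE c h4 hv hw).
rewrite (bilZl h1) (bilZr h3) !scalerA e; congr (_ *: _).
by rewrite cDl cDr; ring.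
Qed.
End WeightedOperations.

(** * Testing equality and invertibility of module morphisms on homogeneous elements *)

Section TensorHomogeneous.
Variables (K : fieldType) (G : zmodType) (lam : commFactor K G).
Variable A : gcAlgebra lam.

(** Homogeneous pure tensors span, and they are the elements on which τ has a closed formula. *)
Lemma gtens_hext (M N P : gmod A) (f f' : gmodHom (gtens M N) P) :
  (forall g h (m : M) (n : N), homog g m -> homog h n ->
     f (tpure m n) = f' (tpure m n)) -> f = f'.
Proof.
move=> e; apply: gmodHom_eq; elim/tensor_hind => //.
by move=> t u IH IH'; rewrite (linD (hlin f)) (linD (hlin f')) IH IH'.
Qed.

Lemma gtens_hext3 (M N P Q : gmod A) (f f' : gmodHom (gtens (gtens M N) P) Q) :
  (forall g h k (m : M) (n : N) (p : P), homog g m -> homog h n -> homog k p ->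
     f (tpure (tpure m n : gtens M N) p)
     = f' (tpure (tpure m n : gtens M N) p)) -> f = f'.
Proof.
move=> e; apply: gtens_hext => g k t p _ hp.
have tb := @tpure_bilin _ _ _ _ (gtens M N) P.
elim/tensor_hind: t => [t u IH IH'|i j m n hm hn]; last exact: e hm hn hp.
by rewrite (bilDl tb) (linD (hlin f)) (linD (hlin f')) IH IH'.
Qed.

Lemma gcompmE (M N P : gmod A) (f : gmodHom N P) (g : gmodHom M N) m :
  gcompm f g m = f (g m).
Proof. by []. Qed.

Lemma tpure_homog (M N : gmod A) g h (m : M) (n : N) :
  homog g m -> homog h n -> homog (g + h) (tpure m n : gtens M N).
Proof. by move=> hm hn; apply: TensHomogPure hm hn erefl. Qed.

(** A set-theoretic inverse is automatically a morphism: linearity and right linearity transfer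
    through the injectivity of [f], and degrees because [f] commutes with homogeneous components. *)
Lemma gmodHom_iso (M N : gmod A) (f : gmodHom M N) (f' : N -> M) :
  cancel f f' -> cancel f' f -> @is_iso (gmod_cat A) M N f.
Proof.
move=> fK f'K; have fl := hlin f; have fi := can_inj fK.
unshelve eexists.
  exists f'.
  - by move=> c u v; apply: fi; rewrite fl !f'K.
  - by move=> m a; apply: fi; rewrite hrmul !f'K.
  (* It is enough that the preimage of [n] equals its own component of degree [g]; both have the
     same image under [f]. *)
  - move=> g n hn; suff -> : f' n = gcomp g (f' n) by apply: gcomp_homog.
    have comp h m : f (gcomp h m) = gcomp h (f m).
      rewrite [m in RHS]gcomp_sum (lin_sum fl).
      rewrite (gcomp_uniq (f := fun k => f (gcomp k m))) ?gsupp_uniq //.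
        by move=> k; apply/hhomog/gcomp_homog.
      by move=> k /gcomp_out ->; rewrite (lin0 fl).
    by apply: fi; rewrite comp f'K (gcompE _ hn) eqxx.
by split; apply: gmodHom_eq => m; rewrite gmcompE gidE /= ?fK ?f'K.
Qed.

(** A degree-preserving linear map has a graded kernel and a graded image, so bijectivity can be
    checked degree by degree. This serves η, whose inverse is explicit on homogeneous maps. *)
Lemma gmodHom_hiso (M N : gmod A) (f : gmodHom M N) :
  (forall g m, homog g m -> f m = 0 -> m = 0) ->
  (forall g n, homog g n -> exists m, f m = n) ->
  @is_iso (gmod_cat A) M N f.
Proof.
move=> f0 fs; have fl := hlin f.
have surj n : exists m, f m = n.
  elim/homog_ind: n => [|n n' [m <-] [m' <-]|g n hn]; last exact: fs hn.
    by exists 0; rewrite (lin0 fl).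
  by exists (m + m'); rewrite (linD fl).
have ker m : f m = 0 -> m = 0.
  move=> fm0; rewrite (gcomp_sum m) big_seq big1 // => g gm.
  apply: (f0 g); first exact: gcomp_homog.
  (* The elements [f (gcomp h m)] are homogeneous of distinct degrees with sum [f m], which is 0;
     hence each of them vanishes. *)
  apply: (homog_indep (gvsP N) (f := fun h => f (gcomp h m)) (gsupp_uniq m)) gm.
    by move=> h; apply/hhomog/gcomp_homog.
  by rewrite -(lin_sum fl) -gcomp_sum.
pose f' n := sval (boolp.cid (surj n)).
have f'K : cancel f' f by move=> n; apply: svalP (boolp.cid (surj n)).
apply: (gmodHom_iso _ f'K) => m; apply/eqP; rewrite -subr_eq0; apply/eqP/ker.
by rewrite addrC -scaleN1r fl scaleN1r f'K addNr.
Qed.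
End TensorHomogeneous.

(** * Twisted modules and the functor on objects and morphisms *)

Section TwistModule.
Variables (K : fieldType) (G : zmodType) (lam : commFactor K G).
Variables (sig : multiplier lam) (A : gcAlgebra lam).
Implicit Types M N P : gmod A.
Local Notation B := (twist sig A).

Section Object.
Variable M : gmod A.

Definition twist_lact : B -> M -> M := weighted sig (@lmul _ _ _ A M).
Definition twist_ract : M -> B -> M := weighted sig (@rmul _ _ _ A M).

Lemma twist_lactE g h (a : B) (m : M) : homog g a -> homog h m ->
  twist_lact a m = sig g h *: lmul (a : A) m.
Proof. exact/weightedE/lmul_bilin. Qed.

Lemma twist_ractE g h (m : M) (a : B) : homog g m -> homog h a ->
  twist_ract m a = sig g h *: rmul m (a : A).
Proof. exact/weightedE/rmul_bilin. Qed.

Fact twist_lact_bilin : bilin twist_lact.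
Proof. exact/weighted_bilin/lmul_bilin. Qed.

Fact twist_ract_bilin : bilin twist_ract.
Proof. exact/weighted_bilin/rmul_bilin. Qed.

Fact twist_lactA (a b : B) m :
  twist_lact a (twist_lact b m) = twist_lact (amul a b) m.
Proof.
apply/esym/weighted_assoc; try exact: lmul_bilin.
- exact: multDl.
- exact: multDr.
- exact: amul_bilin.
- exact: amul_homog.
- exact: lmul_homog.
- by move=> x y z; rewrite lmulA.
Qed.

Fact twist_lact1 m : twist_lact aone m = m.
Proof.
elim/homog_ind: m => [|m m' IH IH'|h m hm].
- exact: (bil0r twist_lact_bilin).
- by rewrite (bilDr twist_lact_bilin) IH IH'.
by rewrite (twist_lactE (aone_homog B) hm) mult0l scale1r lmul1.
Qed.

Fact twist_ractA m (a b : B) :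
  twist_ract (twist_ract m a) b = twist_ract m (amul a b).
Proof.
apply: weighted_assoc; try exact: rmul_bilin.
- exact: multDl.
- exact: multDr.
- exact: amul_bilin.
- by move=> *; apply: rmul_homog.
- exact: amul_homog.
- by move=> x y z; rewrite rmulA.
Qed.

Fact twist_ract1 m : twist_ract m aone = m.
Proof.
elim/homog_ind: m => [|m m' IH IH'|h m hm].
- exact: (bil0l twist_ract_bilin).
- by rewrite (bilDl twist_ract_bilin) IH IH'.
by rewrite (twist_ractE hm (aone_homog B)) mult0r scale1r rmul1.
Qed.

Fact twist_lact_homog g h (a : B) m :
  homog g a -> homog h m -> homog (g + h) (twist_lact a m).
Proof.
by apply: weighted_homog; [exact: lmul_bilin | by move=> *; apply: lmul_homog].
Qed.

Fact twist_ract_homog g h m (a : B) :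
  homog g m -> homog h a -> homog (g + h) (twist_ract m a).
Proof.
by apply: weighted_homog; [exact: rmul_bilin | by move=> *; apply: rmul_homog].
Qed.

(** This is λ(g,h) ς(g,h) = λ^ς(g,h) ς(h,g), the definition of λ^ς. It shows that weighting the
    right action by ς(m,a) gives exactly the right structure determined by the twisted left
    action. *)
Fact twist_ract_lact g h m (a : B) : homog g m -> homog h a ->
  twist_ract m a = twist_cf sig g h *: twist_lact a m.
Proof.
move=> hm ha; rewrite (twist_ractE hm ha) (twist_lactE ha hm) (rmulE hm ha).
rewrite !scalerA; congr (_ *: _).
by rewrite /twist_cf /= /twist_cf_fun mulfVK ?mult_neq0 // mulrC.
Qed.

Definition twist_str : gmodStr B M :=
  GmodStr twist_lact_bilin twist_ract_bilin twist_lactA twist_lact1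
    twist_ractA twist_ract1 twist_lact_homog twist_ract_homog twist_ract_lact.

Definition twist_mod : gmod B := Gmod twist_str.
End Object.

Lemma twist_rmulE (M : gmod A) g h (m : twist_mod M) (a : B) :
  homog g m -> homog h a -> rmul m a = sig g h *: rmul (m : M) (a : A).
Proof. exact: twist_ractE. Qed.

Lemma twist_lmulE (M : gmod A) g h (m : twist_mod M) (a : B) :
  homog g a -> homog h m -> lmul a m = sig g h *: lmul (a : A) (m : M).
Proof. exact: twist_lactE. Qed.

Section Morphism.
Variables (M N : gmod A) (f : gmodHom M N).

(** Since [f] preserves degrees, the same weight ς(g,h) appears on both sides. *)
Fact twist_hom_rmul (m : twist_mod M) (a : B) :
  f (rmul m a) = rmul (f m : twist_mod N) a.
Proof.
have fl := hlin f.
have bM := rmul_bilin (twist_mod M); have bN := rmul_bilin (twist_mod N).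
move: m a; apply: bilin_hext.
- split=> [a|m] c x y; first by rewrite (bilDl bM) (bilZl bM) fl.
  by rewrite (bilDr bM) (bilZr bM) fl.
- split=> [a|m] c x y; first by rewrite fl (bilDl bN) (bilZl bN).
  by rewrite (bilDr bN) (bilZr bN).
move=> g h m a hm ha; rewrite (twist_rmulE hm ha) (linZ fl) hrmul.
by rewrite (twist_rmulE (hhomog f hm) ha).
Qed.

Definition twist_hom : gmodHom (twist_mod M) (twist_mod N) :=
  @GmodHom _ _ _ _ (twist_mod M) (twist_mod N) f (hlin f) twist_hom_rmul
    (@hhomog _ _ _ _ _ _ f).

Lemma twist_homE (m : twist_mod M) : twist_hom m = f m :> N.
Proof. by []. Qed.
End Morphism.

Definition twist_functor_on :
  @functor_on (gmod_cmc A) (gmod_cmc B) twist_mod.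
Proof.
by exists twist_hom => *; apply: gmodHom_eq.
Defined.

(** The identity is right linear by conversion: on both modules the right action unfolds to the
    product of [A] weighted by ς. *)
Definition twist_unit : gmodHom (gunit B) (twist_mod (gunit A)) :=
  @GmodHom _ _ _ _ (gunit B) (twist_mod (gunit A)) id
    (fun c u v => erefl) (fun m a => erefl) (fun g m h => h).

Lemma twist_unit_iso : @is_iso (gmod_cat B) _ _ twist_unit.
Proof.
pose u : twist_mod (gunit A) -> gunit B := id.
by apply: (@gmodHom_iso _ _ _ _ _ _ twist_unit u).
Qed.

(** * The isomorphism τ *)

Section Tensor.
Variables M N : gmod A.

Definition twist_pure (m : twist_mod M) (n : twist_mod N) :
  twist_mod (gtens M N) := weighted sig (@tpure _ _ _ A M N) m n.

Lemma twist_pureE g h m n : homog g m -> homog h n ->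
  twist_pure m n = sig g h *: (tpure (m : M) (n : N) : gtens M N).
Proof.
by move=> hm hn; apply: weightedE hm hn; exact: (@tpure_bilin _ _ _ _ M N).
Qed.

(** Balancedness is an associativity-like identity with the algebra as middle factor. *)
Fact twist_pure_bal : balanced twist_pure.
Proof.
split; first exact: weighted_bilin (@tpure_bilin _ _ _ _ M N).
apply: (@weighted_assoc K G M A N M N (gtens M N)).
- exact: multDl.
- exact: multDr.
- exact: (@tpure_bilin _ _ _ _ M N).
- exact: rmul_bilin.
- exact: (@tpure_bilin _ _ _ _ M N).
- exact: lmul_bilin.
- by move=> *; apply: rmul_homog.
- exact: lmul_homog.
- exact: tpure_bal.
Qed.

(** Here the algebra is the last factor of the associativity-like identity. *)
Fact twist_pure_rmul m n (a : B) :
  twist_pure m (rmul n a) = rmul (twist_pure m n) a.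
Proof.
apply/esym; apply: (@weighted_assoc K G M N A (gtens M N) N).
- exact: multDl.
- exact: multDr.
- exact: rmul_bilin.
- exact: (@tpure_bilin _ _ _ _ M N).
- exact: (@tpure_bilin _ _ _ _ M N).
- exact: rmul_bilin.
- exact: tpure_homog.
- by move=> *; apply: rmul_homog.
- exact: rmul_tpure.
Qed.

Fact twist_pure_homog g h m n :
  homog g m -> homog h n -> homog (g + h) (twist_pure m n).
Proof.
move=> hm hn; rewrite (twist_pureE hm hn).
by apply: homogZ; apply: (@tpure_homog _ _ _ _ M N g h).
Qed.

Definition twist_tens :
  gmodHom (gtens (twist_mod M) (twist_mod N)) (twist_mod (gtens M N)) :=
  gtens_hom twist_pure_bal twist_pure_rmul twist_pure_homog.

Lemma twist_tensE g h (m : twist_mod M) (n : twist_mod N) :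
  homog g m -> homog h n ->
  twist_tens (tpure m n) = sig g h *: (tpure (m : M) (n : N) : gtens M N).
Proof. by move=> hm hn; rewrite gtens_homE; apply: twist_pureE. Qed.

(** The inverse of τ on pairs, before it is factored through the tensor product over [A]. *)
Definition untwist_pure (m : M) (n : N) : gtens (twist_mod M) (twist_mod N) :=
  weighted (fun g h => (sig g h)^-1)
    (@tpure _ _ _ B (twist_mod M) (twist_mod N)) m n.

Lemma untwist_pureE g h (m : M) (n : N) : homog g m -> homog h n ->
  untwist_pure m n
  = (sig g h)^-1 *: (tpure (m : twist_mod M) (n : twist_mod N)
                      : gtens (twist_mod M) (twist_mod N)).
Proof.
move=> hm hn; apply: weightedE hm hn.
exact: (@tpure_bilin _ _ _ B (twist_mod M) (twist_mod N)).
Qed.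

(** The balancing relation over [B] reads ς(g,h) ma ⊗ n = ς(h,k) m ⊗ an in terms of the original
    actions. Dividing by ς(g,h) ς(g+h,k) = ς(h,k) ς(g,h+k) gives the required relation over [A]. *)
Fact untwist_pure_bal : balanced untwist_pure.
Proof.
have tb := @tpure_bilin _ _ _ _ (twist_mod M) (twist_mod N).
have wb : bilin untwist_pure by exact: weighted_bilin tb.
split=> // m a n; have lb := lmul_bilin N; have rb := rmul_bilin M.
elim/homog_ind: m => [|m m' IH IH'|g m hm].
- by rewrite (bil0l rb) !(bil0l wb).
- by rewrite (bilDl rb) !(bilDl wb) IH IH'.
elim/homog_ind: a => [|a a' IH IH'|h a ha].
- by rewrite (bil0l lb) (bil0r rb) (bil0l wb) (bil0r wb).
- by rewrite (bilDl lb) (bilDr rb) (bilDl wb) (bilDr wb) IH IH'.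
elim/homog_ind: n => [|n n' IH IH'|k n hn].
- by rewrite (bil0r lb) !(bil0r wb).
- by rewrite (bilDr lb) !(bilDr wb) IH IH'.
rewrite (untwist_pureE (rmul_homog hm ha) hn).
rewrite (untwist_pureE hm (lmul_homog ha hn)).
have := @tpure_bal _ _ _ B (twist_mod M) (twist_mod N) m a n.
rewrite (@twist_rmulE M g h) // (@twist_lmulE N h k) // => e.
have {}e : sig g h *: (tpure (rmul m a : twist_mod M) (n : twist_mod N)
                         : gtens (twist_mod M) (twist_mod N))
  = sig h k *: (tpure (m : twist_mod M) (lmul a n : twist_mod N)
                         : gtens (twist_mod M) (twist_mod N)).
  by rewrite -(bilZl tb) e (bilZr tb).
(* A factor ς(g,h) is inserted to expose the left side of [e]. *)
have -> : (sig (g + h) k)^-1 = (sig (g + h) k)^-1 * (sig g h)^-1 * sig g h.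
  by rewrite mulfVK ?mult_neq0.
rewrite -scalerA e scalerA; congr (_ *: _); rewrite multDl multDr.
by field; rewrite !mult_neq0.
Qed.

(** The weights ς and its inverse cancel on homogeneous pure tensors; [gmodHom_iso] makes it enough
    to give the inverse as a mere map. *)
Lemma twist_tens_iso : @is_iso (gmod_cat B) _ _ twist_tens.
Proof.
have ul := tlift_lin untwist_pure_bal; have tl := hlin twist_tens.
pose u : twist_mod (gtens M N) -> gtens (twist_mod M) (twist_mod N) :=
  tlift untwist_pure.
apply: (@gmodHom_iso _ _ _ _ _ _ twist_tens u); rewrite {}/u.
- elim/tensor_hind => [t u IH IH'|g h m n hm hn].
    by rewrite (linD tl) (linD ul) IH IH'.
  rewrite (twist_tensE hm hn) (linZ ul) (tliftE untwist_pure_bal).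
  by rewrite (untwist_pureE hm hn) scalerA mulfV ?mult_neq0 // scale1r.
- elim/tensor_hind => [t u IH IH'|g h m n hm hn].
    by rewrite (linD ul) (linD tl) IH IH'.
  rewrite (tliftE untwist_pure_bal) (untwist_pureE hm hn) (linZ tl).
  by rewrite (twist_tensE hm hn) scalerA mulVf ?mult_neq0 // scale1r.
Qed.
End Tensor.

(** * Naturality and coherence of τ *)

Lemma twist_tens_nat M N M' N' (f : gmodHom M M') (g : gmodHom N N') :
  gcompm (twist_tens M' N') (gtensm (twist_hom f) (twist_hom g))
  = gcompm (twist_hom (gtensm f g)) (twist_tens M N).
Proof.
apply: gtens_hext => h k m n hm hn.
rewrite !gcompmE gtensmE twist_homE (twist_tensE hm hn).
rewrite (linZ (hlin (gtensm f g))) gtensmE !twist_homE.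
by rewrite (twist_tensE (hhomog f hm) (hhomog g hn)).
Qed.

(** As m ⊗ n has degree g+h and n ⊗ p degree h+k, the two paths carry ς(g,h) ς(g+h,k) and ς(h,k)
    ς(g,h+k), which agree by biadditivity. *)
Lemma twist_tens_assoc M N P :
  gcompm (gcompm (twist_hom (gassoc M N P)) (twist_tens (gtens M N) P))
    (gtensm (twist_tens M N) (gidm (twist_mod P)))
  = gcompm (gcompm (twist_tens M (gtens N P))
      (gtensm (gidm (twist_mod M)) (twist_tens N P)))
      (gassoc (twist_mod M) (twist_mod N) (twist_mod P)).
Proof.
apply: gtens_hext3 => g h k m n p hm hn hp.
rewrite !gcompmE gtensmE gassocE gtensmE twist_homE.
rewrite (twist_tensE hm hn) (twist_tensE hn hp).
have hmn := homogZ (sig g h) (@tpure_homog _ _ _ _ M N g h m n hm hn).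
have hnp := homogZ (sig h k) (@tpure_homog _ _ _ _ N P h k n p hn hp).
rewrite (@twist_tensE (gtens M N) P _ _ _ _ hmn hp).
rewrite (@twist_tensE M (gtens N P) _ _ _ _ hm hnp).
rewrite (bilZl (@tpure_bilin _ _ _ _ (gtens M N) P)).
rewrite (bilZr (@tpure_bilin _ _ _ _ M (gtens N P))).
rewrite !(linZ (hlin (gassoc M N P))) gassocE !scalerA multDl multDr.
by congr (_ *: _); ring.
Qed.

(** Both sides give ς(g,h) am: the weight comes from τ on the left and from the twisted action on
    the right. *)
Lemma twist_tens_lunit M :
  gcompm (gcompm (twist_hom (glunit M)) (twist_tens (gunit A) M))
    (gtensm twist_unit (gidm (twist_mod M)))
  = glunit (twist_mod M).
Proof.
apply: gtens_hext => g h a m ha hm.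
rewrite !gcompmE gtensmE glunitE twist_homE (@twist_tensE (gunit A) M g h) //.
by rewrite (linZ (hlin (glunit M))) glunitE (@twist_lmulE M g h).
Qed.

Lemma twist_tens_runit M :
  gcompm (gcompm (twist_hom (grunit M)) (twist_tens M (gunit A)))
    (gtensm (gidm (twist_mod M)) twist_unit)
  = grunit (twist_mod M).
Proof.
apply: gtens_hext => g h m a hm ha.
rewrite !gcompmE gtensmE grunitE twist_homE (@twist_tensE M (gunit A) g h) //.
by rewrite (linZ (hlin (grunit M))) grunitE (@twist_rmulE M g h).
Qed.

(** * The comparison η of internal Homs *)

Section InternalHomComparison.
Variables M N : gmod A.

(** This is η spelled out with the concrete operations, so that it is convertible to
    [ihom_comparison]. *)
Definition twist_ihom :
  gmodHom (twist_mod (gihom M N)) (gihom (twist_mod M) (twist_mod N)) :=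
  gcurry (gcompm (twist_hom (gev M N)) (twist_tens (gihom M N) M)).

Lemma twist_ihomE g h (f : gihom M N) (m : M) : homog g f -> homog h m ->
  twist_ihom (f : twist_mod (gihom M N)) (m : twist_mod M) = sig g h *: f m.
Proof.
move=> hf hm; rewrite gcurryE gcompmE twist_homE.
rewrite (@twist_tensE (gihom M N) M g h) //.
by rewrite (linZ (hlin (gev M N))) gevE.
Qed.

Section Inverse.
Variables (g : G) (f : gihom (twist_mod M) (twist_mod N)).
Hypothesis hf : homog g f.

(** Evaluation is retyped between the untwisted [M] and [N], which have the same underlying graded
    spaces, so that the preimage under η can be built there. *)
Definition untwist_ev (F : gihom (twist_mod M) (twist_mod N)) (m : M) : N :=
  F (m : twist_mod M).

Fact untwist_ev_bilin : bilin untwist_ev.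
Proof. by have [] := gev_bal (twist_mod M) (twist_mod N). Qed.

(** The preimage of [f] under η. *)
Definition untwist_fun (m : M) : N :=
  weighted (fun h k => (sig h k)^-1) untwist_ev f m.

Lemma untwist_funE h (m : M) : homog h m ->
  untwist_fun m = (sig g h)^-1 *: (f (m : twist_mod M) : N).
Proof.
by move=> hm; rewrite /untwist_fun (weightedE _ untwist_ev_bilin hf hm).
Qed.

Fact untwist_fun_lin : linear untwist_fun.
Proof. exact: (weighted_bilin _ untwist_ev_bilin).2. Qed.

(** Right [B]-linearity of [f] reads ς(h,k) f(ma) = ς(h+g,k) f(m)a. Dividing by ς(h,k) ς(g,h+k)
    leaves the weight ς(g,h)^-1 on the right, as required. *)
Fact untwist_fun_rmul m a : untwist_fun (rmul m a) = rmul (untwist_fun m) a.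
Proof.
have ul := untwist_fun_lin; have fl := ihom_lin f.
have bM := rmul_bilin M; have bN := rmul_bilin N.
move: m a; apply: bilin_hext.
- split=> [a|m] c x y; first by rewrite (bilDl bM) (bilZl bM) ul.
  by rewrite (bilDr bM) (bilZr bM) ul.
- split=> [a|m] c x y; first by rewrite ul (bilDl bN) (bilZl bN).
  by rewrite (bilDr bN) (bilZr bN).
move=> h k m a hm ha.
rewrite (untwist_funE hm) (untwist_funE (rmul_homog hm ha)) (bilZl bN).
have := @ihom_rmul _ _ _ B (twist_mod M) (twist_mod N) f m a.
(* Since [f] has degree [g], the element [f m] has degree [h + g], which fixes the weight in [N]. *)
rewrite (@twist_rmulE M h k) // (@twist_rmulE N (h + g) k) ?(linZ fl);
  last first.
- exact: ha.
- exact: hf.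
move=> e.
have -> : (sig g (h + k))^-1
    = (sig g (h + k))^-1 * (sig h k)^-1 * sig h k.
  by rewrite mulfVK ?mult_neq0.
rewrite -scalerA e scalerA; congr (_ *: _); rewrite multDl multDr.
by field; rewrite !mult_neq0.
Qed.

Fact untwist_fun_deg : rlinear_deg g untwist_fun.
Proof.
split; [exact: untwist_fun_lin | exact: untwist_fun_rmul |] => h m hm.
by rewrite (untwist_funE hm); apply/homogZ/(hf hm).
Qed.
End Inverse.

(** In each degree, injectivity holds because the weights are nonzero, and [untwist_fun] provides
    preimages. *)
Lemma twist_ihom_iso : @is_iso (gmod_cat B) _ _ twist_ihom.
Proof.
apply: gmodHom_hiso => [g f hf e | g f hf].
- apply: ihom_eq => m; have fl := ihom_lin (f : gihom M N).
  elim/homog_ind: m => [|m m' IH IH'|h m hm]; first by rewrite (lin0 fl).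
    by rewrite (linD fl) IH IH' !ihom0E addr0.
  have := twist_ihomE hf hm; rewrite e => /esym/eqP.
  by rewrite scaler_eq0 (negPf (mult_neq0 _ _ _)) => /eqP.
- pose f' : gihom M N := IhomType (ihom_deg (untwist_fun_deg hf)).
  have hf' : homog g f' by have [_ _] := untwist_fun_deg hf.
  exists f'; apply: ihom_eq => m.
  elim/homog_ind: m => [|m m' IH IH'|h m hm].
  + by rewrite !(lin0 (ihom_lin _)).
  + by rewrite !(linD (ihom_lin _)) IH IH'.
  rewrite (twist_ihomE hf' hm) /= (untwist_funE hf hm) scalerA.
  by rewrite mulfV ?mult_neq0 // scale1r.
Qed.
End InternalHomComparison.
End TwistModule.

Theorem mainTheorem6 (K : fieldType) (charK : [pchar K] =i pred0)
    (G : zmodType) (fgG : finitely_generated G) (lam : commFactor K G)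
    (A : gcAlgebra lam) (sig : multiplier lam) :
  exists s : forall M : gmod A, gmodStr (twist sig A) M,
    (forall (M : gmod A) (g h : G) (a : A) (m : M),
       homog g a -> homog h m -> lact (s M) a m = sig g h *: lmul a m) /\
    exists F : @functor_on (gmod_cmc A) (gmod_cmc (twist sig A))
                 (fun M : gmod A => Gmod (s M)),
      (forall (M N : gmod A) (f : gmodHom M N) (m : M),
         hfun (fmap F f) m = f m) /\
      exists (u : @chom (gmod_cmc (twist sig A)) unitob (Functor F unitob))
             (tau : forall M N : gmod_cmc A,
                chom (tens (Functor F M) (Functor F N)) (Functor F (tens M N))),
        is_monoidal_functor u tau /\
        (forall M N : gmod_cmc A, is_iso (ihom_comparison tau M N)).
Proof.
exists (@twist_str _ _ _ sig A); split.
  by move=> M g h a m; apply: twist_lactE.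
exists (twist_functor_on sig A); split=> //.
exists (twist_unit sig A), (twist_tens sig (A := A)); split.
  (* The abstract diagrams unfold to the concrete composites of the preceding lemmas, so each
     condition is met by conversion. *)
  split.
  - exact: twist_unit_iso.
  - exact: twist_tens_iso.
  - exact: twist_tens_nat.
  - exact: twist_tens_assoc.
  - exact: twist_tens_lunit.
  - exact: twist_tens_runit.
exact: twist_ihom_iso.
Qed.
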